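(* Let $\mathcal{T}$ be an $\mathrm{End}(\iota)$-linear tensor $C^*$-category closed under conjugation, sub-objects and direct sums. Let $\Omega$ be the compact Hausdorff topological space associated to $\mathrm{End}(\iota)\cong C(\Omega)$. Then for each $\omega\in\Omega$ there is an associated tensor $C^*$-category $\mathcal{T}_\omega$ with simple unit object, closed under conjugation and direct sums, the fibre category at the point $\omega$. The arrows of the original category $\mathcal{T}$ can be viewed as continuous sections taking values in the Hom spaces of the fibre categories. The $\circ,\otimes,*$ operations, as well as the conjugation operation of $\mathcal{T}$, preserve the fibre structure.
   Context: A tensor $C^*$-category is a 2-$C^*$-category with one object: a strict tensor category with objects $\rho,\sigma,\dots$, tensor product $\otimes$ and unit object $\iota$, such that every $\mathrm{Hom}(\rho,\sigma)$ is a complex Banach space, there is an antilinear involution $*:\mathrm{Hom}(\rho,\sigma)\to\mathrm{Hom}(\sigma,\rho)$, $\|T\circ S\|\le\|T\|\,\|S\|$, $\|S^*\circ S\|=\|S\|^2$, and $S^*\circ S$ is positive in $\mathrm{End}(\rho)=\mathrm{Hom}(\rho,\rho)$ for $S\in\mathrm{Hom}(\rho,\sigma)$. Then $\mathrm{End}(\iota)$ is a commutative unital $C^*$-algebra, so $\mathrm{End}(\iota)\cong C(\Omega)$ with $\Omega$ compact Hausdorff. The unit is simple if $\mathrm{End}(\iota)\cong\mathbb{C}$. The category is $\mathrm{End}(\iota)$-linear if $1_\rho\otimes k=k\otimes 1_\rho$ for all $k\in\mathrm{End}(\iota)$ and all objects $\rho$. Closed under conjugation: for each $\rho$ there are an object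 $\bar\rho$ and arrows $R\in\mathrm{Hom}(\iota,\bar\rho\otimes\rho)$, $\bar R\in\mathrm{Hom}(\iota,\rho\otimes\bar\rho)$ (a solution of the conjugation equations) with $(\bar R^*\otimes1_\rho)\circ(1_\rho\otimes R)=1_\rho$ and $(R^*\otimes1_{\bar\rho})\circ(1_{\bar\rho}\otimes\bar R)=1_{\bar\rho}$. Closed under sub-objects (projections): for each projection $P\in\mathrm{End}(\rho)$ there are an object $\rho_P$ and $W\in\mathrm{Hom}(\rho_P,\rho)$ with $W^*\circ W=1_{\rho_P}$, $W\circ W^*=P$. Closed under direct sums: for $\rho_1,\rho_2$ there are $\rho$ and $W_i\in\mathrm{Hom}(\rho_i,\rho)$ with $W_i^*\circ W_j=\delta_{ij}1_{\rho_i}$ and $W_1\circ W_1^*+W_2\circ W_2^*=1_\rho$. Fibres: fix a solution $R,\bar R$ for $\rho$. The $C(\Omega)$-valued inner product $\langle T,S\rangle=R^*\circ(1_{\bar\rho}\otimes(S^*\circ T))\circ R$ on $\mathrm{Hom}(\rho,\sigma)$, evaluated at $\omega\in\Omega$, gives by the GNS procedure (quotient by the null vectors, and completion) a fibre space $\mathrm{Hom}(\rho,\sigma)_\omega$; write $T_{|\omega}$ for the image of $T$ in it. The fibre $\mathrm{End}(\rho)_\omega$ carries its quotient $C^*$-norm, and $\mathrm{Hom}(\rho,\sigma)_\omega$ the norm $\|S_{|\omega}\|=\|(S^*\circ S)_{|\omega}\|^{1/2}$. Each arrow $T\in\mathrm{Hom}(\rho,\sigma)$ gives the section $\omega\mapsto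 T_{|\omega}$, and these are the sections called continuous. The fibre category $\mathcal{T}_\omega$ is constructed from the objects $\rho$ of $\mathcal{T}$ with $\omega$ in the support of the function $R^*\circ R\in C(\Omega)$, with Hom spaces $\mathrm{Hom}(\rho,\sigma)_\omega$ and operations $S_{|\omega}\circ T_{|\omega}=(S\circ T)_{|\omega}$, $Q_{|\omega}\otimes S_{|\omega}=(Q\otimes S)_{|\omega}$, $(S_{|\omega})^*=(S^* )_{|\omega}$, and is then completed under projections. *)

(* Defs.v *)
(* MathComp-Analysis, over an arbitrary realType [R]; scalars are R[i]. *)
From HB Require Import structures.
From mathcomp Require Import all_boot all_order all_algebra.
From mathcomp Require Import all_classical all_reals all_analysis.
From mathcomp Require Import complex.

Set Implicit Arguments.
Unset Strict Implicit.
Unset Printing Implicit Defensive.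

Import Order.TTheory GRing.Theory Num.Theory.
Import numFieldNormedType.Exports.

Local Open Scope classical_set_scope.
Local Open Scope ring_scope.
Local Open Scope complex_scope.

Declare Scope tcat_scope.
Delimit Scope tcat_scope with tcat.

(* Tensor products are strict, so associativity and unitality are equalities of
   objects; arrows are transported along them. *)
Definition hom_cast (O : Type) (H : O -> O -> Type) (a a' b b' : O)
    (ea : a = a') (eb : b = b') (f : H a b) : H a' b' :=
  ecast x (H x b') ea (ecast y (H a y) eb f).

Record tensor_data (R : realType) := TensorData {
  obj : Type;
  arr : obj -> obj -> completeNormedModType R[i];
  idm : forall a, arr a a;
  tcomp : forall a b c, arr b c -> arr a b -> arr a c;
  tstar : forall a b, arr a b -> arr b a;
  tunit : obj;
  tobj : obj -> obj -> obj;
  tmor : forall a b c d, arr a b -> arr c d -> arr (tobj a c) (tobj b d)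
}.
Arguments arr {R t} a b.
Arguments idm {R t} a.
Arguments tunit {R t}.

Notation "S <o> T" := (tcomp S T) (at level 40, left associativity) : tcat_scope.
Notation "a <@> b" := (tobj a b) (at level 38, left associativity) : tcat_scope.
Notation "S <x> T" := (tmor S T) (at level 38, left associativity) : tcat_scope.
Local Open Scope tcat_scope.

Definition arr_cast (R : realType) (D : tensor_data R) (a a' b b' : obj D)
    (ea : a = a') (eb : b = b') (f : arr a b) : arr a' b' :=
  @hom_cast (obj D) (fun x y => arr x y) a a' b b' ea eb f.

Definition invertible_endo (R : realType) (D : tensor_data R) (a : obj D)
    (X : arr a a) : Prop :=
  exists Y : arr a a, X <o> Y = idm a /\ Y <o> X = idm a.

Definition spectrum (R : realType) (D : tensor_data R) (a : obj D)
    (X : arr a a) : set R[i] :=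
  [set l | ~ invertible_endo (X - l *: idm a)].

(* In R[i], [0 <= l] says that [l] is real and nonnegative. *)
Definition positive_endo (R : realType) (D : tensor_data R) (a : obj D)
    (X : arr a a) : Prop :=
  tstar X = X /\ spectrum X `<=` [set l | 0 <= l].

Record is_tensor_cstar (R : realType) (D : tensor_data R) : Prop := {
  compA : forall (a b c d : obj D) (S : arr c d) (T : arr b c) (U : arr a b),
    S <o> (T <o> U) = (S <o> T) <o> U;
  comp1m : forall (a b : obj D) (S : arr a b), idm b <o> S = S;
  compm1 : forall (a b : obj D) (S : arr a b), S <o> idm a = S;
  comp_linearl : forall (a b c : obj D) (k : R[i]) (S S' : arr b c)
    (T : arr a b), (k *: S + S') <o> T = k *: (S <o> T) + S' <o> T;
  comp_linearr : forall (a b c : obj D) (k : R[i]) (S : arr b c)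
    (T T' : arr a b), S <o> (k *: T + T') = k *: (S <o> T) + S <o> T';
  starK : forall (a b : obj D) (S : arr a b), tstar (tstar S) = S;
  star_antilinear : forall (a b : obj D) (k : R[i]) (S T : arr a b),
    tstar (k *: S + T) = Num.conj k *: tstar S + tstar T;
  star_comp : forall (a b c : obj D) (S : arr b c) (T : arr a b),
    tstar (S <o> T) = tstar T <o> tstar S;
  norm_comp : forall (a b c : obj D) (S : arr b c) (T : arr a b),
    `|S <o> T| <= `|S| * `|T|;
  norm_star_comp : forall (a b : obj D) (S : arr a b),
    `|tstar S <o> S| = `|S| ^+ 2;
  star_comp_positive : forall (a b : obj D) (S : arr a b),
    positive_endo (tstar S <o> S);
  tmor_linearl : forall (a b c d : obj D) (k : R[i]) (S S' : arr a b)
    (T : arr c d), (k *: S + S') <x> T = k *: (S <x> T) + S' <x> T;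
  tmor_linearr : forall (a b c d : obj D) (k : R[i]) (S : arr a b)
    (T T' : arr c d), S <x> (k *: T + T') = k *: (S <x> T) + S <x> T';
  tmor_id : forall a b : obj D, idm a <x> idm b = idm (a <@> b);
  tmor_comp : forall (a b c a' b' c' : obj D) (S : arr b c) (T : arr a b)
    (S' : arr b' c') (T' : arr a' b'),
    (S <o> T) <x> (S' <o> T') = (S <x> S') <o> (T <x> T');
  tmor_star : forall (a b c d : obj D) (S : arr a b) (T : arr c d),
    tstar (S <x> T) = tstar S <x> tstar T;
  tobjA : forall a b c : obj D, a <@> (b <@> c) = (a <@> b) <@> c;
  tobj1m : forall a : obj D, tunit <@> a = a;
  tobjm1 : forall a : obj D, a <@> tunit = a;
  tmorA : forall (a b c a' b' c' : obj D) (S : arr a a') (T : arr b b')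
    (U : arr c c'),
    arr_cast (tobjA a b c) (tobjA a' b' c') (S <x> (T <x> U)) = (S <x> T) <x> U;
  tmor1m : forall (a b : obj D) (S : arr a b),
    arr_cast (tobj1m a) (tobj1m b) (idm tunit <x> S) = S;
  tmorm1 : forall (a b : obj D) (S : arr a b),
    arr_cast (tobjm1 a) (tobjm1 b) (S <x> idm tunit) = S
}.

Record tensor_cstar_category (R : realType) := TensorCstarCategory {
  tcat_data :> tensor_data R;
  tcatP : is_tensor_cstar tcat_data
}.

Section Properties.
Context (R : realType) (T : tensor_cstar_category R).
Implicit Types rho sigma : obj T.

(* End(iota) is C: a unital algebra isomorphism from C is forced to be
   c |-> c 1. *)
Definition simple_unit : Prop :=
  bijective (fun c : R[i] => c *: idm (@tunit _ T)).

Definition end_unit_linear : Prop :=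
  forall rho (k : arr (@tunit _ T) tunit),
    arr_cast (tobjm1 (tcatP T) rho) (tobjm1 (tcatP T) rho) (idm rho <x> k) =
    arr_cast (tobj1m (tcatP T) rho) (tobj1m (tcatP T) rho) (k <x> idm rho).

Definition conj_equations rho rhob (Q : arr tunit (rhob <@> rho))
    (Qb : arr tunit (rho <@> rhob)) : Prop :=
  arr_cast (esym (tobjA (tcatP T) rho rhob rho)) (tobj1m (tcatP T) rho)
      (tstar Qb <x> idm rho)
    <o> arr_cast (tobjm1 (tcatP T) rho) erefl (idm rho <x> Q) = idm rho
  /\
  arr_cast (esym (tobjA (tcatP T) rhob rho rhob)) (tobj1m (tcatP T) rhob)
      (tstar Q <x> idm rhob)
    <o> arr_cast (tobjm1 (tcatP T) rhob) erefl (idm rhob <x> Qb) = idm rhob.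

Record conj_solution rho := ConjSolution {
  cbar : obj T;
  cR : arr tunit (cbar <@> rho);
  cRb : arr tunit (rho <@> cbar);
  conj_solutionP : conj_equations cR cRb
}.

Definition closed_conj : Prop :=
  forall rho, exists rhob (Q : arr tunit (rhob <@> rho))
    (Qb : arr tunit (rho <@> rhob)), conj_equations Q Qb.

(* The conjugate arrow in Hom(rhob, sigmab) of S in Hom(rho, sigma):
   (1 (x) Qb^* ) o (1 (x) S^* (x) 1) o (Q' (x) 1), where Q' is the first arrow
   of a solution for sigma and Qb the second arrow of a solution for rho. *)
Definition conj_arrow rho sigma rhob sigmab (Qb : arr tunit (rho <@> rhob))
    (Q' : arr tunit (sigmab <@> sigma)) (S : arr rho sigma) : arr rhob sigmab :=
  arr_cast erefl (tobjm1 (tcatP T) sigmab) (idm sigmab <x> tstar Qb)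
    <o> (idm sigmab <x> (tstar S <x> idm rhob))
    <o> arr_cast (tobj1m (tcatP T) rhob)
          (esym (tobjA (tcatP T) sigmab sigma rhob)) (Q' <x> idm rhob).

Definition is_projection rho (P : arr rho rho) : Prop :=
  P <o> P = P /\ tstar P = P.

Definition closed_sub : Prop :=
  forall rho (P : arr rho rho), is_projection P ->
    exists rhoP (W : arr rhoP rho),
      tstar W <o> W = idm rhoP /\ W <o> tstar W = P.

Definition closed_sum : Prop :=
  forall rho1 rho2, exists rho (W1 : arr rho1 rho) (W2 : arr rho2 rho),
    [/\ tstar W1 <o> W1 = idm rho1, tstar W2 <o> W2 = idm rho2,
        tstar W1 <o> W2 = 0, tstar W2 <o> W1 = 0
      & W1 <o> tstar W1 + W2 <o> tstar W2 = idm rho].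

(* [G] is an isometric *-isomorphism of End(iota) onto C(Om).  [R[i]^o] gives
   the complex numbers their norm topology. *)
Record gelfand_iso (Om : topologicalType)
    (G : arr (@tunit _ T) tunit -> Om -> R[i]) : Prop := {
  gelfand_range : range G = [set f | continuous (f : Om -> R[i]^o)];
  gelfand_linear : forall (c : R[i]) k l w, G (c *: k + l) w = c * G k w + G l w;
  gelfand_mul : forall k l w, G (k <o> l) w = G k w * G l w;
  gelfand_one : forall w, G (idm tunit) w = 1;
  gelfand_star : forall k w, G (tstar k) w = Num.conj (G k w);
  gelfand_norm : forall k (M : R[i]), 0 <= M ->
    (`|k| <= M <-> forall w, `|G k w| <= M)
}.

End Properties.

(* [q : V -> H] exhibits [H] as the Hilbert space obtained from the positive
   form [f] on [V] (quotient by the null vectors, then completion): [H] is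
   complete for an inner product that pulls back to [f], and [q] has dense
   range.  Since the inner product is definite, [q v = 0] iff [f v v = 0]. *)
Definition gns_completion (R : realType) (V H : lmodType R[i])
    (f : V -> V -> R[i]) (q : {linear V -> H}) : Prop :=
  exists dot : {dot H for @Num.conj R[i]},
    [/\ forall u v, dot (q u) (q v) = f u v,
        forall (x : H) (e : R[i]), 0 < e ->
          exists v, dot (x - q v) (x - q v) < e
      & forall u : nat -> H,
          (forall e : R[i], 0 < e -> exists N : nat, forall m n : nat,
             (N <= m)%N -> (N <= n)%N -> dot (u m - u n) (u m - u n) < e) ->
          exists x : H, forall e : R[i], 0 < e ->
            exists N : nat, forall n : nat, (N <= n)%N ->
              dot (u n - x) (u n - x) < e].

Section Fibres.
Context (R : realType) (T : tensor_cstar_category R) (Om : topologicalType).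
Context (G : arr (@tunit _ T) tunit -> Om -> R[i]).
Context (sol : forall rho : obj T, conj_solution rho).
Implicit Types rho sigma : obj T.

Definition hom_ip rho sigma (S S' : arr rho sigma) : arr (@tunit _ T) tunit :=
  tstar (cR (sol rho)) <o> (idm (cbar (sol rho)) <x> (tstar S' <o> S))
    <o> cR (sol rho).

Definition obj_support rho : set Om :=
  closure [set w | G (tstar (cR (sol rho)) <o> cR (sol rho)) w != 0].

Definition null_arrow (w : Om) rho sigma (S : arr rho sigma) : Prop :=
  G (hom_ip S S) w = 0.

(* A tensor C*-category containing the objects of [T] supported at [w], with
   the same tensor products; [fgerm S] is the value at [w] of the arrow [S]. *)
Record fibre_data (w : Om) := FibreData {
  fcat :> tensor_cstar_category R;
  fobj : forall rho, obj_support rho w -> obj fcat;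
  fgerm : forall rho sigma (hr : obj_support rho w) (hs : obj_support sigma w),
    {linear arr rho sigma -> arr (fobj hr) (fobj hs)};
  support_unit : obj_support tunit w;
  support_tobj : forall rho sigma,
    obj_support rho w -> obj_support sigma w -> obj_support (rho <@> sigma) w;
  fobj_unit : fobj support_unit = tunit;
  fobj_tobj : forall rho sigma (hr : obj_support rho w) (hs : obj_support sigma w),
    fobj (support_tobj hr hs) = fobj hr <@> fobj hs
}.

Section OneFibre.
Context (w : Om) (F : fibre_data w).

Definition fibre_gns : Prop :=
  forall rho sigma (hr : obj_support rho w) (hs : obj_support sigma w),
    gns_completion (fun S S' : arr rho sigma => G (hom_ip S S') w)
      (fgerm F hr hs).

Definition fibre_quotient_norm : Prop :=
  forall rho (hr : obj_support rho w) (X : arr rho rho),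
    (forall N : arr rho rho, null_arrow w N ->
       `|fgerm F hr hr X| <= `|X + N|) /\
    (forall e : R[i], 0 < e ->
       exists2 N : arr rho rho, null_arrow w N &
         `|X + N| < `|fgerm F hr hr X| + e).

Definition fibre_hom_norm : Prop :=
  forall rho sigma (hr : obj_support rho w) (hs : obj_support sigma w)
    (S : arr rho sigma),
    `|fgerm F hr hs S| = sqrtC `|fgerm F hr hr (tstar S <o> S)|.

(* [F] is generated by the objects of [T] supported at [w] through
   completion under projections. *)
Definition fibre_projection_completion : Prop :=
  closed_sub F /\
  forall x : obj F, exists rho (hr : obj_support rho w) (W : arr x (fobj F hr)),
    tstar W <o> W = idm x.

Definition is_fibre_category : Prop :=
  [/\ fibre_gns, fibre_quotient_norm, fibre_hom_norm
    & fibre_projection_completion].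

Definition preserves_comp : Prop :=
  (forall rho (hr : obj_support rho w),
     fgerm F hr hr (idm rho) = idm (fobj F hr)) /\
  (forall rho sigma tau (hr : obj_support rho w) (hs : obj_support sigma w)
     (ht : obj_support tau w) (S : arr sigma tau) (S' : arr rho sigma),
     fgerm F hr ht (S <o> S') = fgerm F hs ht S <o> fgerm F hr hs S').

Definition preserves_tensor : Prop :=
  forall rho rho' sigma sigma' (hr : obj_support rho w) (hr' : obj_support rho' w)
    (hs : obj_support sigma w) (hs' : obj_support sigma' w)
    (Q : arr rho rho') (S : arr sigma sigma'),
    arr_cast (fobj_tobj F hr hs) (fobj_tobj F hr' hs')
      (fgerm F (support_tobj F hr hs) (support_tobj F hr' hs') (Q <x> S)) =
    fgerm F hr hr' Q <x> fgerm F hs hs' S.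

Definition preserves_star : Prop :=
  forall rho sigma (hr : obj_support rho w) (hs : obj_support sigma w)
    (S : arr rho sigma),
    fgerm F hs hr (tstar S) = tstar (fgerm F hr hs S).

Definition germ_unit_tobj rho sigma (hr : obj_support rho w) (hs : obj_support sigma w)
    (Q : arr tunit (rho <@> sigma)) : arr tunit (fobj F hr <@> fobj F hs) :=
  arr_cast (fobj_unit F) (fobj_tobj F hr hs)
    (fgerm F (support_unit F) (support_tobj F hr hs) Q).

Definition preserves_conj_solutions : Prop :=
  forall rho (hr : obj_support rho w) (c : conj_solution rho),
    exists hb : obj_support (cbar c) w,
      conj_equations (germ_unit_tobj hb hr (cR c)) (germ_unit_tobj hr hb (cRb c)).

Definition preserves_conj_arrows : Prop :=
  forall rho sigma (c : conj_solution rho) (d : conj_solution sigma)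
    (hr : obj_support rho w) (hs : obj_support sigma w)
    (hrb : obj_support (cbar c) w) (hsb : obj_support (cbar d) w) (S : arr rho sigma),
    fgerm F hrb hsb (conj_arrow (cRb c) (cR d) S) =
    conj_arrow (germ_unit_tobj hr hrb (cRb c)) (germ_unit_tobj hsb hs (cR d))
      (fgerm F hr hs S).

End OneFibre.

Section Sections.
Context (F : forall w : Om, fibre_data w).

Definition fibre_section rho sigma : Type :=
  forall (w : Om) (hr : obj_support rho w) (hs : obj_support sigma w),
    arr (fobj (F w) hr) (fobj (F w) hs).

Definition arrow_section rho sigma (S : arr rho sigma) :
    fibre_section rho sigma :=
  fun w hr hs => fgerm (F w) hr hs S.

(* The continuous sections are, by definition, those given by arrows. *)
Definition continuous_sections rho sigma : set (fibre_section rho sigma) :=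
  range (@arrow_section rho sigma).

End Sections.
End Fibres.

Arguments arrow_section {R T Om G sol} F {rho sigma} S.
Arguments continuous_sections {R T Om G sol} F rho sigma.

(* Main.v *)
(* The norm of the germ at [w] of an arrow [S] is the infimum of [|S k|] over the
   scalars [k] of End(iota) with [k(w) = 1] and [|k| <= 1].  Since scalars are
   central and act compatibly with tensor products, this is a C*-seminorm, and
   dividing by its null space gives a tensor C*-category with the same objects.

   A unital *-homomorphism of C*-algebras is contractive, because a self-adjoint
   strict contraction is the mean of two unitaries; hence tensoring with an
   identity is contractive.  The conjugation equations express [S] through
   [Z = (1 (x) S) o R], and [<S, S> = Z^* o Z], so that
   [|S|^2 <= |Rb|^2 |<S, S>|]; localizing [S] near [w] by scalars, the norm of the
   germ of [S] is equivalent to [<S, S>(w)^(1/2)].  So the quotients are the Hilbert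
   spaces of the GNS construction.  Projections of the quotient category need not
   lift to [T], so it is completed formally under projections.  The conjugate of a
   subobject is cut out of the conjugate of the object by the range projection of
   the transposed (idempotent, not self-adjoint) projection. *)
From HB Require Import structures.
Require Import Defs.
From mathcomp Require Import all_boot all_order all_algebra.
From mathcomp Require Import all_classical all_reals all_analysis.
From mathcomp Require Import complex.
From mathcomp Require Import ring lra.

Set Implicit Arguments.
Unset Strict Implicit.
Unset Printing Implicit Defensive.

Import Order.TTheory GRing.Theory Num.Theory.
Import numFieldNormedType.Exports.
Import Normc.

Local Open Scope classical_set_scope.
Local Open Scope ring_scope.
Local Open Scope complex_scope.
Local Open Scope tcat_scope.

(** * Seminorms and quotients *)

Section RealNorm.
Context (R : realType).

(** The GNS seminorm depends on the chosen solution and is not visibly submultiplicative, so the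
    fibre norm is built without it: for an infimum over localizing scalars the C*-axioms follow by
    multiplying such scalars and taking adjoints. It also lets Cauchy sequences of germs lift to
    Cauchy sequences of arrows, so the quotients are complete as they stand and the completion in
    the GNS procedure adds nothing. Strictness shapes the rest. Equalities of objects must survive
    in the fibre: the quotient therefore keeps the objects themselves, the completion under
    projections takes pairs of an object and a projection, and diagram chases use arrows bundled
    with their endpoints, free of casts. Functional calculus is reduced to two devices: square roots
    by a fixed-point iteration, and inverses of [1 + D^* o D] from positivity. *)

Definition nrm (V : normedModType R[i]) (x : V) : R := complex.Re `|x|.

Section Nrm.
Context (V : normedModType R[i]).
Implicit Types (x y : V) (c : R[i]).

Lemma nrmE x : `|x| = (nrm x)%:C.
Proof. by rewrite /nrm RRe_real // ger0_real. Qed.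

Lemma nrm_ge0 x : 0 <= nrm x.
Proof. by rewrite -ler0c -nrmE. Qed.

Lemma nrm0 : nrm (0 : V) = 0.
Proof. by rewrite /nrm normr0. Qed.

Lemma nrm_eq0 x : nrm x = 0 -> x = 0.
Proof. by move=> x0; apply/normr0_eq0; rewrite nrmE x0. Qed.

Lemma nrmD x y : nrm (x + y) <= nrm x + nrm y.
Proof. by rewrite -lecR rmorphD /= -!nrmE ler_normD. Qed.

Lemma nrmZ c x : nrm (c *: x) = normc c * nrm x.
Proof.
by apply: complexI; rewrite -nrmE normrZ rmorphM /= nrmE.
Qed.

Lemma nrmN x : nrm (- x) = nrm x.
Proof. by rewrite /nrm normrN. Qed.

Lemma nrmB x y : nrm (x - y) = nrm (y - x).
Proof. by rewrite /nrm distrC. Qed.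

Lemma nrm_le_tri x y z : nrm (x - z) <= nrm (x - y) + nrm (y - z).
Proof. by rewrite (le_trans _ (nrmD _ _)) // addrA subrK. Qed.

End Nrm.

Lemma normcR (x : R) : 0 <= x -> normc x%:C = x.
Proof. move=> x0; apply: complexI; rewrite -[RHS]ger0_norm ?lecR //. Qed.

(** Testing only geometric increments suffices, since a Cauchy filter can be followed by such a
    sequence ([quot_complete]); it makes the condition easy to check for infima and corners. *)
Definition seq_complete (V : zmodType) (p : V -> R) :=
  forall u : nat -> V, (forall j, p (u j.+1 - u j) <= 2^-1 ^+ j) ->
  exists x, forall e, 0 < e -> exists N, forall j, (N <= j)%N -> p (u j - x) < e.

Lemma geo_lt (q e : R) : 0 <= q < 1 -> 0 < e ->
  exists N, forall j, (N <= j)%N -> q ^+ j < e.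
Proof.
move=> /andP[q0 q1] e0; have := @cvg_expr R q; rewrite ger0_norm //.
move=> /(_ q1) /cvgrPdist_lt /(_ _ e0) [N _ HN]; exists N => j Nj.
by have := HN j Nj; rewrite /= sub0r normrN ger0_norm // exprn_ge0.
Qed.

Lemma half_lt1 : 0 <= (2^-1 : R) < 1.
Proof. by rewrite invr_ge0 ler0n invf_lt1 ?ltr1n. Qed.

Lemma geo_cauchy (V : zmodType) (p : V -> R) (p0 : p 0 = 0)
    (pD : forall x y, p (x + y) <= p x + p y) (q : R) (u : nat -> V) :
  0 <= q < 1 -> (forall j, p (u j.+1 - u j) <= q ^+ j) ->
  forall m n, (m <= n)%N -> (1 - q) * p (u n - u m) <= q ^+ m.
Proof.
move=> /andP[q0 q1] ub m n mn; have q'0 : 0 <= 1 - q by lra.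
(* The difference [q ^+ m - q ^+ n] telescopes, so the induction can carry it. *)
suff : (1 - q) * p (u n - u m) <= q ^+ m - q ^+ n.
  by have := exprn_ge0 n q0; lra.
move: mn => /subnK <-; elim: (n - m)%N => [|k IH].
  by rewrite add0n !subrr p0 mulr0.
rewrite addSn -(subrK (u (k + m)%N) (u _)) -addrA.
apply: (le_trans (ler_wpM2l q'0 (pD _ _))).
have := ler_wpM2l q'0 (ub (k + m)%N).
rewrite [_ ^+ (k + m).+1]exprS; move: IH; set a := q ^+ (k + m); lra.
Qed.

Lemma nrm_cauchy_cvg (V : completeNormedModType R[i]) (u : nat -> V) :
  (forall e : R, 0 < e -> exists N, forall m n, (N <= m)%N -> (N <= n)%N ->
    nrm (u m - u n) < e) ->
  exists x, forall e, 0 < e -> exists N, forall j, (N <= j)%N -> nrm (u j - x) < e.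
Proof.
move=> uC.
have : cvg (u @ \oo).
  apply: cauchy_cvg; apply/cauchy_exP => e e0.
  have er : e = (complex.Re e)%:C by rewrite RRe_real // gtr0_real.
  rewrite er ltcR in e0; have [N HN] := uC _ e0.
  exists (u N), N => // n /= Nn.
  by rewrite -ball_normE /= nrmE er ltcR; exact: HN.
move=> /cvg_ex [x /cvgrPdist_lt ux]; exists x => e e0.
have /ux [N _ HN] : 0 < e%:C by rewrite ltcR.
by exists N => j Nj; have := HN j Nj; rewrite /= nrmE ltcR nrmB.
Qed.

Lemma nrm_geo_cvg (V : completeNormedModType R[i]) (q : R) (u : nat -> V) :
  0 <= q < 1 -> (forall j, nrm (u j.+1 - u j) <= q ^+ j) ->
  exists x, forall e, 0 < e -> exists N, forall j, (N <= j)%N -> nrm (u j - x) < e.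
Proof.
move=> q01 ub; apply: nrm_cauchy_cvg => e e0.
have [q0 q1] := andP q01; have q'0 : 0 < (1 - q) / 4 by lra.
have [N HN] := geo_lt q01 (mulr_gt0 q'0 e0).
exists N => m n Nm Nn; rewrite -(subrK (u N) (u m)) -addrA.
apply: (le_lt_trans (nrmD _ _)); rewrite [nrm (u N - _)]nrmB.
have H k : (N <= k)%N -> nrm (u k - u N) < e / 4.
  move=> Nk; have := geo_cauchy (nrm0 V) (@nrmD V) q01 ub Nk.
  move=> /le_lt_trans /(_ (HN _ (leqnn N))).
  by rewrite -mulrA ltr_pM2l; lra.
by have := H _ Nm; have := H _ Nn; lra.
Qed.

Lemma nrm_complete (V : completeNormedModType R[i]) : seq_complete (@nrm V).
Proof. by move=> u; apply: nrm_geo_cvg; exact: half_lt1. Qed.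

End RealNorm.

(* [can] selects a representative of each class modulo the null vectors of [sn];
   the quotient is modelled as the set of representatives. *)
Record cseminorm (R : realType) (V : lmodType R[i]) := CSeminorm {
  sn :> V -> R;
  can : V -> V;
  sn_ge0 : forall x, 0 <= sn x;
  snD : forall x y, sn (x + y) <= sn x + sn y;
  snZ : forall c x, sn (c *: x) = normc c * sn x;
  sn_seq_complete : seq_complete sn;
  canP : forall x, sn (can x - x) = 0;
  can_eq : forall x y, sn (x - y) = 0 -> can x = can y
}.

Section Quotient.
Context (R : realType) (V : lmodType R[i]) (p : cseminorm V).
Implicit Types x y : V.

Lemma snN x : p (- x) = p x.
Proof. by rewrite -scaleN1r snZ normcN normc1 mul1r. Qed.

Lemma snB x y : p (x - y) = p (y - x).
Proof. by rewrite -snN opprB. Qed.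

Lemma sn_eq x y : p (x - y) = 0 -> p x = p y.
Proof.
suff H a b : p (a - b) = 0 -> p a <= p b.
  by move=> E; apply/le_anti; rewrite !H // snB.
by move=> E; rewrite -(subrK b a) (le_trans (snD _ _ _)) // E add0r.
Qed.

Lemma can_idem x : can p (can p x) = can p x.
Proof. by apply: can_eq; exact: canP. Qed.

Definition quot : Type := {x : V | can p x == x}.

HB.instance Definition _ := Choice.on quot.

Definition qpi x : quot := exist _ (can p x) (introT eqP (can_idem x)).
Definition qval (q : quot) : V := val q.

Lemma qvalK : cancel qval qpi.
Proof. by case=> x /[dup] /eqP E xP; apply: val_inj; rewrite /= E. Qed.

Lemma qpiP x y : qpi x = qpi y <-> p (x - y) = 0.
Proof.
split=> [[E]|E]; last by apply: val_inj; exact: can_eq.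
apply/le_anti; rewrite sn_ge0 andbT -(subrK (can p x) x) -addrA.
by rewrite (le_trans (snD _ _ _)) // snB canP E canP addr0.
Qed.

Lemma qvalP x : p (qval (qpi x) - x) = 0.
Proof. exact: canP. Qed.

Definition qadd (a b : quot) := qpi (qval a + qval b).
Definition qopp (a : quot) := qpi (- qval a).
Definition qscale c (a : quot) := qpi (c *: qval a).

Lemma sn_le0 x : p x <= 0 -> p x = 0.
Proof. by move=> E; apply/le_anti; rewrite E sn_ge0. Qed.

Lemma qaddE x y : qadd (qpi x) (qpi y) = qpi (x + y).
Proof.
apply/qpiP/sn_le0; rewrite opprD addrACA (le_trans (snD _ _ _)) //.
by rewrite !qvalP addr0.
Qed.

Lemma qoppE x : qopp (qpi x) = qpi (- x).
Proof. by apply/qpiP; rewrite -opprD snN qvalP. Qed.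

Lemma qscaleE c x : qscale c (qpi x) = qpi (c *: x).
Proof. by apply/qpiP; rewrite -scalerBr snZ qvalP mulr0. Qed.

Lemma quotW (P : quot -> Prop) : (forall x, P (qpi x)) -> forall q, P q.
Proof. by move=> H q; rewrite -(qvalK q). Qed.

Lemma qaddA : associative qadd.
Proof. by do 3!elim/quotW=> ?; rewrite !qaddE addrA. Qed.
Lemma qaddC : commutative qadd.
Proof. by do 2!elim/quotW=> ?; rewrite !qaddE addrC. Qed.
Lemma qadd0 : left_id (qpi 0) qadd.
Proof. by elim/quotW=> ?; rewrite !qaddE add0r. Qed.
Lemma qaddN : left_inverse (qpi 0) qopp qadd.
Proof. by elim/quotW=> ?; rewrite qoppE qaddE addNr. Qed.

HB.instance Definition _ := GRing.isZmodule.Build quot qaddA qaddC qadd0 qaddN.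

Lemma qscaleA a b q : qscale a (qscale b q) = qscale (a * b) q.
Proof. by elim/quotW: q => x; rewrite !qscaleE scalerA. Qed.
Lemma qscale1 : left_id 1 qscale.
Proof. by elim/quotW=> x; rewrite !qscaleE scale1r. Qed.
Lemma qscaleDr : right_distributive qscale +%R.
Proof.
by move=> c; do 2!elim/quotW=> ?; rewrite /GRing.add /= qaddE !qscaleE qaddE scalerDr.
Qed.
Lemma qscaleDl q : {morph qscale^~ q : a b / a + b}.
Proof.
by move=> a b; elim/quotW: q => x; rewrite /GRing.add /= !qscaleE qaddE scalerDl.
Qed.

HB.instance Definition _ := GRing.Zmodule_isLmodule.Build R[i] quot
  qscaleA qscale1 qscaleDr qscaleDl.

Lemma qpi_linear : linear qpi.
Proof. by move=> c x y; rewrite /GRing.add /GRing.scale /= qscaleE qaddE. Qed.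

HB.instance Definition _ := GRing.isLinear.Build R[i] V quot _ qpi qpi_linear.

Definition qnorm (q : quot) : R[i] := (p (qval q))%:C.

Lemma qnormE x : qnorm (qpi x) = (p x)%:C.
Proof. by rewrite /qnorm (sn_eq (qvalP x)). Qed.

Lemma qnormD (a b : quot) : qnorm (a + b) <= qnorm a + qnorm b.
Proof.
elim/quotW: a => x; elim/quotW: b => y.
by rewrite -linearD !qnormE -rmorphD /= lecR snD.
Qed.

Lemma qnormZ c (a : quot) : qnorm (c *: a) = `|c| * qnorm a.
Proof.
by elim/quotW: a => x; rewrite -linearZ /= !qnormE snZ rmorphM.
Qed.

Lemma qnorm_eq0 (a : quot) : qnorm a = 0 -> a = 0.
Proof.
elim/quotW: a => x; rewrite qnormE => /complexI x0.
by rewrite -(linear0 qpi); apply/qpiP; rewrite subr0.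
Qed.

HB.instance Definition _ := Lmodule_isNormed.Build R[i] quot qnormD qnormZ qnorm_eq0.

Lemma nrm_qpi x : nrm (qpi x) = p x.
Proof. by apply: complexI; rewrite -nrmE [LHS]qnormE. Qed.

Lemma nrm_qval (q : quot) : p (qval q) = nrm q.
Proof. by rewrite -{2}(qvalK q) nrm_qpi. Qed.

Lemma quot_complete (F : set_system quot) : ProperFilter F -> cauchy F -> cvg F.
Proof.
move=> FF /cauchy_ballP FC.
have half_gt0 j : 0 < (2^-1 : R) ^+ j by rewrite exprn_gt0 // invr_gt0.
(* The balls around [q j] and [q j.+1] both belong to [F], hence meet; with exponent [j.+2] the
   increments stay below [2^-1 ^+ j]. *)
have ex j : exists q : quot, F [set q' | nrm (q - q') < 2^-1 ^+ j.+2].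
  have e0 : 0 < ((2^-1 : R) ^+ j.+2)%:C by rewrite ltcR.
  have [q Hq] := (cauchyP F).1 ((cauchy_ballP F).1 FC) _ e0.
  exists q; apply: filterS Hq => q'.
  by rewrite -ball_normE /= nrmE ltcR.
have [q Hq] := choice ex.
have qq j : p (qval (q j.+1) - qval (q j)) <= 2^-1 ^+ j.
  have [y [/= y1 y2]] := filter_ex (filterI (Hq j) (Hq j.+1)).
  rewrite -nrm_qpi linearB /= !qvalK.
  apply: le_trans (nrm_le_tri _ y _) _; rewrite [nrm (y - _)]nrmB.
  apply: ltW (lt_le_trans (ltrD y2 y1) _).
  rewrite !exprS; move: (half_gt0 j); set a := _ ^+ j; lra.
have [x Hx] := sn_seq_complete qq.
apply/cvg_ex; exists (qpi x); apply/cvgrPdist_lt => e e0.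
have er : e = (complex.Re e)%:C by rewrite RRe_real // gtr0_real.
rewrite er ltcR in e0; have e20 : 0 < complex.Re e / 2 by rewrite divr_gt0.
have [N HN] := Hx _ e20; have [M HM] := geo_lt (half_lt1 R) e20.
pose j := maxn N M; apply: filterS (Hq j) => y /= yj.
rewrite nrmE er ltcR; apply: le_lt_trans (nrm_le_tri _ (q j) _) _.
have := HN j (leq_maxl _ _); rewrite -nrm_qpi linearB /= qvalK nrmB.
have := HM j.+2 (leq_trans (leq_maxr N M) (leq_trans (leqnSn _) (leqnSn _))).
move: yj; lra.
Qed.

HB.instance Definition _ := Uniform_isComplete.Build quot quot_complete.

Definition quot_mod : completeNormedModType R[i] := quot.

End Quotient.

(** * Arrows without casts *)

(* Arrows with bundled source and target: the strict associativity and unit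
   laws become plain equations, at the price of a partial composition. *)
Record harr (R : realType) (D : tensor_data R) := Harr {
  hdom : obj D; hcod : obj D; hhom : arr hdom hcod
}.
Arguments Harr {R D hdom hcod} hhom.

Section Untyped.
Context (R : realType) (T : tensor_cstar_category R).
Implicit Types (F K L : harr T) (a b c d : obj T).

Lemma arr_cast_id a b (ea : a = a) (eb : b = b) (f : arr a b) :
  arr_cast ea eb f = f.
Proof.
by rewrite (Prop_irrelevance ea erefl) (Prop_irrelevance eb erefl).
Qed.

(** [ev] reads an arrow back off its bundle after deciding whether the endpoints match; irrelevance
    of equality proofs makes the remaining casts trivial. *)
Lemma Harr_inj a b (f g : arr a b) : Harr f = Harr g -> f = g.
Proof.
pose ev (K : harr T) : arr a b :=
  match pselect (hdom K = a), pselect (hcod K = b) with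
  | left ea, left eb => arr_cast ea eb (hhom K) | _, _ => f end.
have evE h : ev (Harr h) = h.
  by rewrite /ev; do 2 (case: pselect => // ?); exact: arr_cast_id.
by move=> /(congr1 ev); rewrite !evE.
Qed.

Lemma Harr_cast a a' b b' (ea : a = a') (eb : b = b') (f : arr a b) :
  Harr (arr_cast ea eb f) = Harr f.
Proof. by case: a' / ea; case: b' / eb. Qed.

Lemma arr_castP a a' b b' (ea : a = a') (eb : b = b') (f : arr a b) (g : arr a' b') :
  Harr f = Harr g -> arr_cast ea eb f = g.
Proof. by move=> E; apply: Harr_inj; rewrite Harr_cast. Qed.

Definition hid a := Harr (idm a).
Definition hstar F := Harr (tstar (hhom F)).
Definition htens F K := Harr (hhom F <x> hhom K).
(** The default [F] has the right codomain, so that [hcomp_cod] holds without a side condition. *)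
Definition hcomp F K : harr T :=
  match pselect (hcod K = hdom F) with
  | left e => Harr (hhom F <o> arr_cast erefl e (hhom K))
  | right _ => F
  end.

Lemma Harr_comp a b c (f : arr b c) (g : arr a b) :
  Harr (f <o> g) = hcomp (Harr f) (Harr g).
Proof.
by rewrite /hcomp; case: pselect => // e; rewrite arr_cast_id.
Qed.

Lemma hcomp_dom F K : hcod K = hdom F -> hdom (hcomp F K) = hdom K.
Proof. by rewrite /hcomp; case: pselect. Qed.

Lemma hcomp_cod F K : hcod (hcomp F K) = hcod F.
Proof. by rewrite /hcomp; case: pselect. Qed.

Lemma hcompA F K L : hcod K = hdom F -> hcod L = hdom K ->
  hcomp F (hcomp K L) = hcomp (hcomp F K) L.
Proof.
case: F => a b f; case: K => c d g; case: L => e h k /= E1 E2.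
by case: a / E1 f => f; case: c / E2 g => g; rewrite -!Harr_comp (Defs.compA (tcatP T)).
Qed.

Lemma hcomp1m F a : hcod F = a -> hcomp (hid a) F = F.
Proof.
by case: F => b c f /= <-; rewrite -Harr_comp (comp1m (tcatP T)).
Qed.

Lemma hcompm1 F a : hdom F = a -> hcomp F (hid a) = F.
Proof.
by case: F => b c f /= <-; rewrite -Harr_comp (compm1 (tcatP T)).
Qed.

Lemma hstar_comp F K : hcod K = hdom F ->
  hstar (hcomp F K) = hcomp (hstar K) (hstar F).
Proof.
case: F => a b f; case: K => c d g /= E.
by case: a / E f => f; rewrite -!Harr_comp -(star_comp (tcatP T)).
Qed.

Lemma hstar_tens F K : hstar (htens F K) = htens (hstar F) (hstar K).
Proof. by rewrite /hstar /= (tmor_star (tcatP T)). Qed.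

Lemma hstarK F : hstar (hstar F) = F.
Proof. by case: F => a b f; rewrite /hstar /= (starK (tcatP T)). Qed.

Lemma hstar_id a : tstar (idm a) = idm a :> arr (t := T) a a.
Proof.
rewrite -[LHS](comp1m (tcatP T)) -{1}(starK (tcatP T) (idm a)).
by rewrite -(star_comp (tcatP T)) (comp1m (tcatP T)) (starK (tcatP T)).
Qed.

Lemma htensA F K L : htens F (htens K L) = htens (htens F K) L.
Proof. by rewrite /htens /= -(tmorA (tcatP T)) Harr_cast. Qed.

Lemma htens1m F : htens (hid tunit) F = F.
Proof.
by case: F => a b f; rewrite -[in RHS](tmor1m (tcatP T) f) Harr_cast.
Qed.

Lemma htensm1 F : htens F (hid tunit) = F.
Proof.
by case: F => a b f; rewrite -[in RHS](tmorm1 (tcatP T) f) Harr_cast.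
Qed.

Lemma htens_id a b : htens (hid a) (hid b) = hid (a <@> b).
Proof. by rewrite /htens /= (tmor_id (tcatP T)). Qed.

Lemma htens_comp F F' K K' : hcod F' = hdom F -> hcod K' = hdom K ->
  htens (hcomp F F') (hcomp K K') = hcomp (htens F K) (htens F' K').
Proof.
case: F => a b f; case: F' => a' b' f'; case: K => c d g; case: K' => c' d' g'.
rewrite /= => E1 E2; case: a / E1 f => f; case: c / E2 g => g.
by rewrite -!Harr_comp /htens /= (tmor_comp (tcatP T)) Harr_comp.
Qed.

Lemma conj_equationsE rho rhob (Q : arr tunit (rhob <@> rho))
    (Qb : arr tunit (rho <@> rhob)) :
  conj_equations Q Qb <->
  hcomp (htens (hstar (Harr Qb)) (hid rho)) (htens (hid rho) (Harr Q)) = hid rho /\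
  hcomp (htens (hstar (Harr Q)) (hid rhob)) (htens (hid rhob) (Harr Qb)) = hid rhob.
Proof.
have H1 : Harr (arr_cast (esym (tobjA (tcatP T) rho rhob rho)) (tobj1m (tcatP T) rho)
      (tstar Qb <x> idm rho)
    <o> arr_cast (tobjm1 (tcatP T) rho) erefl (idm rho <x> Q)) =
    hcomp (htens (hstar (Harr Qb)) (hid rho)) (htens (hid rho) (Harr Q)).
  by rewrite Harr_comp !Harr_cast.
have H2 : Harr (arr_cast (esym (tobjA (tcatP T) rhob rho rhob)) (tobj1m (tcatP T) rhob)
      (tstar Q <x> idm rhob)
    <o> arr_cast (tobjm1 (tcatP T) rhob) erefl (idm rhob <x> Qb)) =
    hcomp (htens (hstar (Harr Q)) (hid rhob)) (htens (hid rhob) (Harr Qb)).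
  by rewrite Harr_comp !Harr_cast.
by rewrite -H1 -H2; split=> -[E1 E2]; split; [rewrite E1|rewrite E2|exact: Harr_inj..].
Qed.

Lemma conj_arrowE rho sigma rhob sigmab (Qb : arr tunit (rho <@> rhob))
    (Q' : arr tunit (sigmab <@> sigma)) (S : arr rho sigma) :
  Harr (conj_arrow Qb Q' S) =
  hcomp (hcomp (htens (hid sigmab) (hstar (Harr Qb)))
    (htens (hid sigmab) (htens (hstar (Harr S)) (hid rhob))))
    (htens (Harr Q') (hid rhob)).
Proof. by rewrite /conj_arrow !Harr_comp !Harr_cast. Qed.

End Untyped.

(** * Norm estimates *)

Lemma linear_rules (K : nzRingType) (U V : lmodType K) (f : U -> V) :
  (forall k x y, f (k *: x + y) = k *: f x + f y) ->
  [/\ f 0 = 0, forall x y, f (x + y) = f x + f y,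
      forall x, f (- x) = - f x & forall k x, f (k *: x) = k *: f x].
Proof.
move=> fL.
have f0 : f 0 = 0.
  have := fL (-1) 0 0; rewrite scaler0 addr0 scaleN1r addNr; exact.
have fZ k x : f (k *: x) = k *: f x by rewrite -[k *: x]addr0 fL f0 addr0.
split=> // [x y|x]; first by rewrite -[x]scale1r fL !scale1r.
by rewrite -!scaleN1r fZ.
Qed.

Lemma le0_of_eps (R : realType) (a C : R) :
  0 < C -> (forall e : R, 0 < e -> a <= C * e) -> a <= 0.
Proof.
move=> C0 H; rewrite leNgt; apply/negP => a0.
have := H (a / (2 * C)); rewrite divr_gt0 ?mulr_gt0 // => /(_ isT).
have -> : C * (a / (2 * C)) = a / 2 by field; rewrite gt_eqF.
lra.
Qed.

Lemma ler_of_eps (R : realType) (a b : R) :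
  (forall e : R, 0 < e -> a <= b + e) -> a <= b.
Proof.
move=> H; rewrite -subr_le0; apply: (@le0_of_eps _ _ 1) => // e e0.
by rewrite lerBlDl mul1r; exact: H.
Qed.

Lemma two_half (R : realType) : 2%:R * (2^-1)%:C = 1 :> R[i].
Proof. by rewrite -[2%:R](rmorph_nat (real_complex R)) -rmorphM /= mulfV. Qed.

Section Arrows.
Context (R : realType) (T : tensor_cstar_category R).
Implicit Types a b c d : obj T.

Section Bilinear.
Context a b c d.
Implicit Types (k : R[i]).

Definition compl_rules (S : arr a b) :=
  linear_rules (f := fun X : arr b c => X <o> S)
    (fun k x y => comp_linearl (tcatP T) k x y S).

Lemma comp0m (S : arr a b) : (0 : arr b c) <o> S = 0.
Proof. by case: (compl_rules S). Qed.
Lemma compDl (S : arr a b) (X Y : arr b c) : (X + Y) <o> S = X <o> S + Y <o> S.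
Proof. by case: (compl_rules S). Qed.
Lemma compNl (S : arr a b) (X : arr b c) : (- X) <o> S = - (X <o> S).
Proof. by case: (compl_rules S). Qed.
Lemma compZl (S : arr a b) k (X : arr b c) : (k *: X) <o> S = k *: (X <o> S).
Proof. by case: (compl_rules S). Qed.
Lemma compBl (S : arr a b) (X Y : arr b c) : (X - Y) <o> S = X <o> S - Y <o> S.
Proof. by rewrite compDl compNl. Qed.

Definition compr_rules (S : arr b c) :=
  linear_rules (f := fun X : arr a b => S <o> X)
    (fun k x y => comp_linearr (tcatP T) k S x y).

Lemma compm0 (S : arr b c) : S <o> (0 : arr a b) = 0.
Proof. by case: (compr_rules S). Qed.
Lemma compDr (S : arr b c) (X Y : arr a b) : S <o> (X + Y) = S <o> X + S <o> Y.
Proof. by case: (compr_rules S). Qed.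
Lemma compNr (S : arr b c) (X : arr a b) : S <o> (- X) = - (S <o> X).
Proof. by case: (compr_rules S). Qed.
Lemma compZr (S : arr b c) k (X : arr a b) : S <o> (k *: X) = k *: (S <o> X).
Proof. by case: (compr_rules S). Qed.
Lemma compBr (S : arr b c) (X Y : arr a b) : S <o> (X - Y) = S <o> X - S <o> Y.
Proof. by rewrite compDr compNr. Qed.

Definition tensl_rules (S : arr c d) :=
  linear_rules (f := fun X : arr a b => X <x> S)
    (fun k x y => tmor_linearl (tcatP T) k x y S).

Lemma tensDl (S : arr c d) (X Y : arr a b) : (X + Y) <x> S = X <x> S + Y <x> S.
Proof. by case: (tensl_rules S). Qed.
Lemma tensNl (S : arr c d) (X : arr a b) : (- X) <x> S = - (X <x> S).
Proof. by case: (tensl_rules S). Qed.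
Lemma tensBl (S : arr c d) (X Y : arr a b) : (X - Y) <x> S = X <x> S - Y <x> S.
Proof. by rewrite tensDl tensNl. Qed.

Definition tensr_rules (S : arr a b) :=
  linear_rules (f := fun X : arr c d => S <x> X)
    (fun k x y => tmor_linearr (tcatP T) k S x y).

Lemma tensDr (S : arr a b) (X Y : arr c d) : S <x> (X + Y) = S <x> X + S <x> Y.
Proof. by case: (tensr_rules S). Qed.
Lemma tensNr (S : arr a b) (X : arr c d) : S <x> (- X) = - (S <x> X).
Proof. by case: (tensr_rules S). Qed.
Lemma tensZr (S : arr a b) k (X : arr c d) : S <x> (k *: X) = k *: (S <x> X).
Proof. by case: (tensr_rules S). Qed.
Lemma tensBr (S : arr a b) (X Y : arr c d) : S <x> (X - Y) = S <x> X - S <x> Y.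
Proof. by rewrite tensDr tensNr. Qed.

Lemma starD (X Y : arr a b) : tstar (X + Y) = tstar X + tstar Y.
Proof.
by have := star_antilinear (tcatP T) 1 X Y; rewrite rmorph1 !scale1r.
Qed.
Lemma star0 : tstar (0 : arr a b) = 0.
Proof. by apply: (addrI (tstar (0 : arr a b))); rewrite -starD !addr0. Qed.
Lemma starZ k (X : arr a b) : tstar (k *: X) = Num.conj k *: tstar X.
Proof. by rewrite -[k *: X]addr0 (star_antilinear (tcatP T)) star0 addr0. Qed.
Lemma starN (X : arr a b) : tstar (- X) = - tstar X.
Proof. by rewrite -scaleN1r starZ rmorphN rmorph1 scaleN1r. Qed.
Lemma starB (X Y : arr a b) : tstar (X - Y) = tstar X - tstar Y.
Proof. by rewrite starD starN. Qed.

End Bilinear.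

Lemma compAl a b c d (S : arr c d) (U : arr b c) (V : arr a b) :
  S <o> U <o> V = S <o> (U <o> V).
Proof. by rewrite (Defs.compA (tcatP T)). Qed.

Lemma tens_comp a b c a' b' c' (S : arr b c) (U : arr a b)
    (S' : arr b' c') (U' : arr a' b') :
  (S <x> S') <o> (U <x> U') = (S <o> U) <x> (S' <o> U').
Proof. by rewrite (tmor_comp (tcatP T)). Qed.

Section Norms.
Context a b c.

Lemma nrm_comp (S : arr b c) (U : arr a b) : nrm (S <o> U) <= nrm S * nrm U.
Proof. by rewrite -lecR rmorphM /= -!nrmE (norm_comp (tcatP T)). Qed.

Lemma nrm_sq (S : arr a b) : nrm (tstar S <o> S) = nrm S ^+ 2.
Proof. by apply: complexI; rewrite rmorphXn /= -!nrmE (norm_star_comp (tcatP T)). Qed.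

End Norms.

Lemma nrm_star a b (S : arr a b) : nrm (tstar S) = nrm S.
Proof.
suff H c d (U : arr c d) : nrm U <= nrm (tstar U).
  apply/le_anti; rewrite H andbT.
  by have := H _ _ (tstar S); rewrite (starK (tcatP T)).
have := nrm_comp (tstar U) U; rewrite nrm_sq expr2.
have [->|U0] := eqVneq (nrm U) 0; first by rewrite nrm_ge0.
by rewrite ler_pM2r // lt_neqAle eq_sym U0 nrm_ge0.
Qed.

Lemma nrm_idm a : nrm (idm a) <= 1.
Proof.
have := nrm_sq (idm a); rewrite hstar_id (comp1m (tcatP T)) => E.
rewrite leNgt; apply/negP => x1; nra.
Qed.

Lemma nrm_cast a a' b b' (ea : a = a') (eb : b = b') (S : arr a b) :
  nrm (arr_cast ea eb S) = nrm S.
Proof. by case: a' / ea; case: b' / eb. Qed.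

(** * Square roots, unitaries and contractivity of *-homomorphisms *)

Section SquareRoot.
Context a (X H : arr a a) (X_sa : tstar X = X) (X_lt1 : nrm X < 1).
Context (HX : H <o> X = X <o> H).

Local Notation half := ((2^-1)%:C : R[i]).
Local Notation step := (fun Y : arr a a => half *: (X + Y <o> Y)).

Lemma nrm_half (Y : arr a a) : nrm (half *: Y) = 2^-1 * nrm Y.
Proof. by rewrite nrmZ normcR ?invr_ge0. Qed.

(* [1 - Y] is a square root of [1 - X] iff [Y = (X + Y^2) / 2]. *)
Lemma sqrt_fixpoint : exists Y : arr a a,
  [/\ Y = half *: (X + Y <o> Y), tstar Y = Y & H <o> Y = Y <o> H].
Proof.
(* All iterates have norm at most [q = (1 + nrm X) / 2 < 1], and on that ball [step] contracts by
   the factor [q]. *)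
have [q qE] : exists q, q = (1 + nrm X) / 2 by eexists.
have X0 := nrm_ge0 X; have X1 := X_lt1.
have q01 : 0 <= q < 1 by lra.
pose u j := iter j step 0.
have step_lip (Y Z : arr a a) : nrm (step Y - step Z) <=
    (nrm Y + nrm Z) / 2 * nrm (Y - Z).
  rewrite -scalerBr nrm_half opprD addrACA subrr add0r.
  have -> : Y <o> Y - Z <o> Z = Y <o> (Y - Z) + (Y - Z) <o> Z.
    by rewrite compBr compBl addrA subrK.
  have := nrmD (Y <o> (Y - Z)) ((Y - Z) <o> Z).
  have := nrm_comp Y (Y - Z); have := nrm_comp (Y - Z) Z; lra.
have uq j : nrm (u j) <= q.
  elim: j => [|j IH]; first by rewrite nrm0; case/andP: q01.
  rewrite /u iterS -/(u j) nrm_half; have := nrmD X (u j <o> u j).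
  have := nrm_comp (u j) (u j); have := nrm_ge0 (u j).
  have : nrm (u j) <= 1 by case/andP: q01 => _; move: IH; lra.
  move=> y1 y0; have : nrm (u j) * nrm (u j) <= 1 by rewrite mulr_ile1.
  lra.
have ub j : nrm (u j.+1 - u j) <= q ^+ j.
  elim: j => [|j IH].
    rewrite /u /= subr0 comp0m addr0 nrm_half expr0; lra.
  rewrite [u j.+1]iterS [u j.+2]iterS -/(u j) -/(u j.+1).
  apply: (le_trans (step_lip _ _)); rewrite exprS; apply: ler_pM => //.
  - by rewrite divr_ge0 // addr_ge0 // nrm_ge0.
  - exact: nrm_ge0.
  - by have := uq j; have := uq j.+1; lra.
have [Y HY] := nrm_geo_cvg q01 ub.
(* Lipschitz equations that hold along the iteration pass to its limit; this yields self-adjointness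
   and commutation with [H]. *)
have stable (P : arr a a -> Prop) (f : arr a a -> arr a a) (C : R) : 0 < C ->
    (forall U V, nrm (f U - f V) <= C * nrm (U - V)) ->
    (forall j, f (u j) = 0) -> f Y = 0.
  move=> C0 fC fu; apply/nrm_eq0/le_anti; rewrite nrm_ge0 andbT.
  apply: (@le0_of_eps _ _ C C0) => e e0; have [N HN] := HY _ e0.
  have := fC Y (u N); rewrite fu subr0 nrmB => /le_trans; apply.
  by rewrite ler_pM2l // ltW // HN.
have usa j : tstar (u j) = u j.
  elim: j => [|j IH]; first exact: star0.
  rewrite [u _]iterS -/(u j) starZ starD X_sa (star_comp (tcatP T)) IH.
  by rewrite [Num.conj _]conjc_real.
have uH j : H <o> u j = u j <o> H.
  elim: j => [|j IH]; first by rewrite compm0 comp0m.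
  rewrite [u _]iterS -/(u j) compZr compZl compDr compDl HX.
  by rewrite (Defs.compA (tcatP T)) IH -!(Defs.compA (tcatP T)) IH.
exists Y; split.
- apply/eqP; rewrite -subr_eq0; apply/eqP/nrm_eq0/le_anti; rewrite nrm_ge0 andbT.
  have C0 : 0 < 2 + nrm Y by have := nrm_ge0 Y; lra.
  apply: (le0_of_eps C0) => e e0; have [N HN] := HY _ e0.
  apply: (le_trans (nrm_le_tri _ (u N.+1) _)).
  rewrite nrmB [u _]iterS -/(u N); have := step_lip (u N) Y.
  have := HN _ (leqnSn N); rewrite [u _]iterS -/(u N).
  have := HN _ (leqnn N); have := uq N; have := nrm_ge0 Y.
  have := nrm_ge0 (u N - Y); have := nrm_ge0 (u N).
  case/andP: q01 => _ q1; nra.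
- apply/eqP; rewrite -subr_eq0; apply/eqP.
  apply: (stable (fun=> True) (fun U => tstar U - U) 2) => //.
    move=> U V.
    have -> : tstar U - U - (tstar V - V) = tstar (U - V) - (U - V).
      by rewrite starB !opprD !opprK addrACA.
    by have := nrmD (tstar (U - V)) (- (U - V)); rewrite nrmN nrm_star; lra.
  by move=> j; rewrite usa subrr.
- apply/eqP; rewrite -subr_eq0; apply/eqP.
  have C0 : 0 < 2 * nrm H + 1 by have := nrm_ge0 H; lra.
  apply: (stable (fun=> True) (fun U => H <o> U - U <o> H) _ C0).
    move=> U V; have -> : H <o> U - U <o> H - (H <o> V - V <o> H) =
        H <o> (U - V) - (U - V) <o> H.
      by rewrite compBr compBl !opprD !opprK addrACA.
    have := nrmD (H <o> (U - V)) (- ((U - V) <o> H)); rewrite nrmN.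
    have := nrm_comp H (U - V); have := nrm_comp (U - V) H.
    have := nrm_ge0 (U - V); lra.
  by move=> j; rewrite uH subrr.
Qed.

Lemma sqrt_one_sub : exists K : arr a a,
  [/\ K <o> K = idm a - X, tstar K = K & H <o> K = K <o> H].
Proof.
have [Y [YE Ys YH]] := sqrt_fixpoint; exists (idm a - Y); split.
- rewrite compBl compBr compBr !(comp1m (tcatP T)) (compm1 (tcatP T)).
  have -> : Y <o> Y = 2%:R *: Y - X.
    rewrite {3}YE scalerA.
    by rewrite two_half scale1r addrAC subrr add0r.
  by rewrite scaler_nat mulr2n opprB [Y + Y - X - Y]addrAC addrK addrA subrK.
- by rewrite starB hstar_id Ys.
- by rewrite compBr compBl (comp1m (tcatP T)) (compm1 (tcatP T)) YH.
Qed.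

End SquareRoot.

(** [U = H + i K] with [K] a square root of [1 - H^2]; since [K] commutes with [H], the cross terms
    of [U^* o U] cancel. *)
Lemma sum_of_unitaries a (H : arr a a) : tstar H = H -> nrm H < 1 ->
  exists U, tstar U <o> U = idm a /\ H = (2^-1)%:C *: (U + tstar U).
Proof.
move=> Hs H1.
have XsA : tstar (H <o> H) = H <o> H by rewrite (star_comp (tcatP T)) Hs.
have X1 : nrm (H <o> H) < 1.
  have := nrm_sq H; rewrite Hs => ->; have := nrm_ge0 H; nra.
have [K [KK Ks HK]] := sqrt_one_sub XsA X1 (Defs.compA (tcatP T) H H H).
pose U := H + 'i *: K; exists U.
have Us : tstar U = H - 'i *: K.
  rewrite starD Hs starZ Ks -scaleNr; congr (_ + _ *: _).
  by apply/eqP; rewrite eq_complex /= oppr0 !eqxx.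
split; rewrite Us.
  rewrite compBl !compDr compZl compZr !compZr compZl scalerA HK KK.
  have -> : 'i * 'i = -1 :> R[i] by rewrite -expr2 sqr_i.
  by rewrite scaleN1r opprD opprK addrA addrK addrC subrK.
rewrite /U addrACA subrr addr0 -[H + H]mulr2n -[H *+ 2]scaler_nat scalerA.
by rewrite mulrC two_half scale1r.
Qed.

(* A *-homomorphism maps unitaries to unitaries, and a self-adjoint strict
   contraction is the mean of a unitary and its adjoint. *)
Lemma star_hom_contractive a b (phi : arr a a -> arr b b) :
  (forall k x y, phi (k *: x + y) = k *: phi x + phi y) ->
  (forall x y, phi (x <o> y) = phi x <o> phi y) ->
  (forall x, phi (tstar x) = tstar (phi x)) -> phi (idm a) = idm b ->
  forall x, nrm (phi x) <= nrm x.
Proof.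
move=> phiL phiM phis phi1; have [_ phiD _ phiZ] := linear_rules phiL.
have sa1 H : tstar H = H -> nrm H < 1 -> nrm (phi H) <= 1.
  move=> Hs /(sum_of_unitaries Hs) [U [U1 ->]].
  rewrite phiZ nrmZ normcR ?invr_ge0 // phiD phis.
  have : nrm (phi U) <= 1.
    have := nrm_sq (phi U); rewrite -phis -phiM U1 phi1.
    have := nrm_idm b; have := nrm_ge0 (phi U); nra.
  have := nrmD (phi U) (tstar (phi U)); rewrite nrm_star; lra.
have sa H : tstar H = H -> nrm (phi H) <= nrm H.
  (* Dividing by [nrm H + e] gives a strict contraction, also when [H] vanishes. *)
  move=> Hs; apply: ler_of_eps => e e0; have H0 := nrm_ge0 H.
  have c0 : 0 < nrm H + e by rewrite ltr_wpDl.
  have := sa1 ((nrm H + e)^-1%:C *: H).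
  have ci : 0 <= (nrm H + e)^-1 by rewrite invr_ge0 ltW.
  rewrite starZ Hs [Num.conj _]conjc_real phiZ !nrmZ (normcR ci).
  rewrite ![(nrm H + e)^-1 * _]mulrC ltr_pdivrMr // ler_pdivrMr // !mul1r ltrDl.
  exact.
move=> x; have := sa (tstar x <o> x).
rewrite phiM phis !nrm_sq (star_comp (tcatP T)) (starK (tcatP T)) => /(_ erefl).
by rewrite ler_pXn2r // ?nnegrE nrm_ge0.
Qed.

(** Contractivity is known for *-homomorphisms between endomorphism algebras; it is applied to
    [S^* o S] and carried back to [S] by the C*-identity. *)
Lemma nrm_tensr a b c (S : arr a b) : nrm (idm c <x> S) <= nrm S.
Proof.
have : nrm (idm c <x> (tstar S <o> S)) <= nrm (tstar S <o> S).
  apply: (star_hom_contractive (phi := fun X => idm c <x> X)).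
  - by move=> k x y; rewrite (tmor_linearr (tcatP T)).
  - by move=> x y; rewrite tens_comp (comp1m (tcatP T)).
  - by move=> x; rewrite (tmor_star (tcatP T)) hstar_id.
  - exact: (tmor_id (tcatP T)).
have -> : idm c <x> (tstar S <o> S) = tstar (idm c <x> S) <o> (idm c <x> S).
  by rewrite (tmor_star (tcatP T)) hstar_id tens_comp (comp1m (tcatP T)).
by rewrite !nrm_sq ler_pXn2r // ?nnegrE nrm_ge0.
Qed.

Lemma nrm_tensl a b c (S : arr a b) : nrm (S <x> idm c) <= nrm S.
Proof.
have : nrm ((tstar S <o> S) <x> idm c) <= nrm (tstar S <o> S).
  apply: (star_hom_contractive (phi := fun X => X <x> idm c)).
  - by move=> k x y; rewrite (tmor_linearl (tcatP T)).
  - by move=> x y; rewrite tens_comp (comp1m (tcatP T)).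
  - by move=> x; rewrite (tmor_star (tcatP T)) hstar_id.
  - exact: (tmor_id (tcatP T)).
have -> : (tstar S <o> S) <x> idm c = tstar (S <x> idm c) <o> (S <x> idm c).
  by rewrite (tmor_star (tcatP T)) hstar_id tens_comp (comp1m (tcatP T)).
by rewrite !nrm_sq ler_pXn2r // ?nnegrE nrm_ge0.
Qed.

End Arrows.

(** * Conjugates of subobjects *)

Notation "F ** K" := (htens F K) (at level 38, left associativity) : tcat_scope.
Notation "F '@@' K" := (hcomp F K) (at level 40, left associativity) : tcat_scope.

(** Proves that endpoints match: it computes the endpoints of composites and normalizes objects by
    the strict associativity and unit laws. *)
Ltac composable := simpl; rewrite ?hcomp_cod;
  repeat (rewrite hcomp_dom; [|solve [composable]]); simpl;
  rewrite ?(tobj1m (tcatP _)) ?(tobjm1 (tcatP _)) ?(tobjA (tcatP _)); reflexivity.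

Section Conjugates.
Context (R : realType) (T : tensor_cstar_category R).
Implicit Types (F K : harr T) (a b c d : obj T).

Lemma hslidel F K b c : hdom F = b -> hcod K = c ->
  (F ** hid c) @@ (hid b ** K) = F ** K.
Proof.
by move=> <- <-; rewrite -htens_comp // hcompm1 // hcomp1m.
Qed.

Lemma hslider F K b c : hcod F = b -> hdom K = c ->
  (hid b ** K) @@ (F ** hid c) = F ** K.
Proof.
by move=> <- <-; rewrite -htens_comp // hcompm1 // hcomp1m.
Qed.

Lemma htens_compl F K a : hcod K = hdom F ->
  (F @@ K) ** hid a = (F ** hid a) @@ (K ** hid a).
Proof. by move=> E; rewrite -htens_comp // hcomp1m. Qed.

Lemma htens_compr F K a : hcod K = hdom F ->
  hid a ** (F @@ K) = (hid a ** F) @@ (hid a ** K).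
Proof. by move=> E; rewrite -htens_comp // hcomp1m. Qed.

Lemma hstar_hid a : hstar (hid a) = hid a :> harr T.
Proof. by rewrite /hstar /= hstar_id. Qed.

(* [1 + D^* o D] is invertible and commutes with [E], where [D = E - E^*], and
   [E o E^* o (1 + D^* o D)^-1] is the range projection. *)
Lemma range_projection a (E : arr a a) : E <o> E = E ->
  exists Q : arr a a, [/\ is_projection Q, Q <o> E = E & E <o> Q = Q].
Proof.
move=> EE; pose D := E - tstar E.
(* The spectrum of [D^* o D] is nonnegative, so [-1] lies outside it and [D^* o D + 1] has an
   inverse [v]. *)
have [_ /(_ (-1))] := star_comp_positive (tcatP T) D.
rewrite /spectrum /= => spD.
have [v [zv vz]] : invertible_endo (tstar D <o> D - (-1) *: idm a).
  by apply: contrapT => /spD; rewrite oppr_ge0 ler10.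
move: zv vz; rewrite scaleN1r opprK; set z := _ + idm a => zv vz.
have Es : tstar E <o> tstar E = tstar E by rewrite -(star_comp (tcatP T)) EE.
have zE : z = tstar E <o> E - tstar E - (E - E <o> tstar E) + idm a.
  by rewrite /z /D starB (starK (tcatP T)) compBl !compBr EE Es.
have zs : tstar z = z.
  by rewrite /z starD hstar_id (star_comp (tcatP T)) (starK (tcatP T)).
(* Both [E o z] and [z o E] equal [E E^* E]; hence [v] commutes with [E], and
   [E E^* v E = E z v = E]. *)
have Ez : E <o> z = E <o> tstar E <o> E.
  rewrite zE compDr (compm1 (tcatP T)) !compBr !(Defs.compA (tcatP T)) EE.
  by rewrite opprB addrA !subrK.
have zE' : z <o> E = E <o> tstar E <o> E.
  rewrite zE compDl (comp1m (tcatP T)) !compBl EE !compAl EE subrr sub0r opprB.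
  by rewrite subrK.
have vs : tstar v = v.
  rewrite -[LHS](compm1 (tcatP T)) -zv (Defs.compA (tcatP T)) -{1}zs.
  by rewrite -(star_comp (tcatP T)) zv hstar_id (comp1m (tcatP T)).
have vE : v <o> E = E <o> v.
  rewrite -[LHS](compm1 (tcatP T)) -zv !(Defs.compA (tcatP T)) 2!compAl.
  rewrite [E <o> (z <o> v)](Defs.compA (tcatP T)).
  by rewrite Ez -zE' !(Defs.compA (tcatP T)) vz (comp1m (tcatP T)).
have vEs : v <o> tstar E = tstar E <o> v.
  by rewrite -{1}vs -(star_comp (tcatP T)) -vE (star_comp (tcatP T)) vs.
have Qs : tstar (E <o> tstar E <o> v) = E <o> tstar E <o> v.
  rewrite !(star_comp (tcatP T)) (starK (tcatP T)) vs (Defs.compA (tcatP T)) vE.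
  by rewrite compAl vEs (Defs.compA (tcatP T)).
have QE : E <o> tstar E <o> v <o> E = E.
  by rewrite compAl vE (Defs.compA (tcatP T)) -Ez compAl zv (compm1 (tcatP T)).
have EQ : E <o> (E <o> tstar E <o> v) = E <o> tstar E <o> v.
  by rewrite !(Defs.compA (tcatP T)) EE.
exists (E <o> tstar E <o> v); split=> //; split=> //.
(* With [Q] the candidate, [Q Q = Q (E Q) = (Q E) Q = E Q = Q]. *)
by rewrite -{2}EQ (Defs.compA (tcatP T)) QE EQ.
Qed.

(** [f] and [g] sit on the strand that the zigzag straightens, [m] and [n] on the strand where cap
    and cup are joined. Once the middle [m o n] is absorbed by [q], only the original zigzag
    remains. Both conjugation equations of a subobject are instances. *)
Lemma zigzag_sub c d y z (q : arr (d <@> c) tunit) (r : arr tunit (c <@> d))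
    (f : arr y d) (m : arr z c) (n : arr c z) (g : arr d y) :
  (Harr q ** hid d) @@ (hid d ** Harr r) = hid d ->
  Harr q @@ (Harr f ** (Harr m @@ Harr n)) = Harr q @@ (Harr f ** hid c) ->
  (Harr (q <o> (f <x> m)) ** hid y) @@ (hid y ** Harr ((n <x> g) <o> r)) =
  Harr (g <o> f).
Proof.
move=> qr mn; rewrite !Harr_comp.
rewrite htens_compl // htens_compr // hcompA; [|composable|composable].
rewrite -[(_ ** hid y) @@ _ @@ _]hcompA; [|composable|composable].
rewrite -[Harr (f <x> m)]/(Harr f ** Harr m) -[Harr (n <x> g)]/(Harr n ** Harr g).
have -> : (Harr f ** Harr m ** hid y) @@ (hid y ** (Harr n ** Harr g)) =
    Harr f ** (Harr m @@ Harr n) ** Harr g.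
  by rewrite [hid y ** _]htensA -htens_comp // -htens_comp // hcompm1 // hcomp1m.
rewrite -htens_comp; [|composable..]; rewrite hcomp1m // mn.
set qf := Harr q @@ _.
have [qfd qfc] : hdom qf = y <@> c /\ hcod qf = tunit.
  by rewrite /qf hcomp_cod hcomp_dom.
rewrite -(@hslider qf (Harr g) tunit d) //.
rewrite htens1m -hcompA; [|by rewrite /= ?qfc ?qfd; composable..]; congr (_ @@ _).
rewrite /qf htens_compl // -!htensA htens_id -hcompA; [|composable..].
rewrite (@hslidel (Harr f) (Harr r)) // -(@hslider (Harr f) (Harr r) d tunit) //.
by rewrite htensm1 hcompA ?qr ?hcomp1m //; composable.
Qed.

Section Subobject.
Context (a ab : obj T) (Q : arr tunit (ab <@> a)) (Qb : arr tunit (a <@> ab)).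
Context (QQb : conj_equations Q Qb).
Let r := Harr Q.
Let rb := Harr Qb.

Let h1 : (hstar rb ** hid a) @@ (hid a ** r) = hid a.
Proof. by case/conj_equationsE: QQb. Qed.

Let h2 : (hstar r ** hid ab) @@ (hid ab ** rb) = hid ab.
Proof. by case/conj_equationsE: QQb. Qed.

Let h2s : (hid ab ** hstar rb) @@ (r ** hid ab) = hid ab.
Proof.
have := congr1 (@hstar _ T) h2; rewrite hstar_comp; last by composable.
by rewrite !hstar_tens !hstar_hid hstarK.
Qed.

(** By the adjoint of the second conjugation equation, an endomorphism of [ab] can be recovered from
    its composite with [rb^*]; identities between endomorphisms of [ab] may thus be checked under
    [rb^*]. *)
Lemma transposeK (f : arr ab ab) :
  (hid ab ** (hstar rb @@ (hid a ** Harr f))) @@ (r ** hid ab) = Harr f.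
Proof.
rewrite htens_compr // htensA htens_id -hcompA; [|composable|composable].
rewrite (@hslider r (Harr f)) // -(@hslidel r (Harr f) tunit ab) //.
by rewrite htens1m hcompA ?h2s ?hcomp1m //; composable.
Qed.

(* The transpose of an idempotent of [a] is an idempotent of its conjugate [ab],
   in general not self-adjoint. *)
Section Transpose.
Context (k : arr (a <@> ab) tunit).
Let kt := (hid ab ** Harr k) @@ (r ** hid ab).

Lemma transposer : hstar rb @@ (hid a ** kt) = Harr k.
Proof.
rewrite htens_compr ?htensA ?htens_id; [|composable]; rewrite hcompA; [|composable|composable].
rewrite -[hstar rb in LHS]htensm1 (@hslidel (hstar rb) (Harr k)) //.
rewrite -(@hslider (hstar rb) (Harr k) tunit (a <@> ab)) // htens1m.
rewrite -hcompA; [|composable|composable].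
rewrite -htens_id htensA -htens_compl ?h1; last by composable.
by rewrite htens_id hcompm1.
Qed.

Lemma transposel : (kt ** hid a) @@ r =
  (hid ab ** ((Harr k ** hid a) @@ (hid a ** r))) @@ r.
Proof.
rewrite htens_compl; last composable.
rewrite -!htensA htens_id -hcompA; [|composable|composable].
rewrite -[X in (r ** _) @@ X]htens1m (@hslidel r r) //.
rewrite -(@hslider r r (ab <@> a) tunit) // htensm1 hcompA; [|composable|composable].
by rewrite htens_compr -?htens_id -?htensA //; composable.
Qed.

End Transpose.

Context (P : arr a a) (PP : P <o> P = P).
Let p := Harr P.
Let k := tstar Qb <o> (P <x> idm ab).

(** [conj_arrow] stars its argument, so this is the transpose of [P] itself. *)
Let E : arr ab ab := conj_arrow Qb Q (tstar P).
Let e := Harr E.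

Let eE : e = (hid ab ** Harr k) @@ (r ** hid ab).
Proof.
rewrite /e conj_arrowE /hstar /= (starK (tcatP T)) -/(hstar rb) -/p.
by rewrite /k Harr_comp htens_compr.
Qed.

(** Across the cup [r], [e] on the conjugate strand becomes [p] on the other one; [rbe] is the same
    for the cap [rb^*]. *)
Let er : (e ** hid a) @@ r = (hid ab ** p) @@ r.
Proof.
rewrite eE transposel; congr ((_ ** _) @@ _).
rewrite /k Harr_comp htens_compl // -/rb -hcompA; [|composable|composable].
rewrite -/(htens p (hid ab)).
rewrite -htensA htens_id (@hslidel p r) // -(@hslider p r a tunit) // htensm1.
by rewrite hcompA ?h1 ?hcomp1m //; composable.
Qed.

Let rbe : hstar rb @@ (hid a ** e) = hstar rb @@ (p ** hid ab).
Proof. by rewrite eE transposer /k Harr_comp. Qed.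

Lemma transpose_idem : E <o> E = E.
Proof.
apply: Harr_inj; rewrite -[LHS]transposeK Harr_comp -/e (@htens_compr e e) //.
rewrite hcompA // rbe.
rewrite -hcompA // (@hslidel p e) // -(@hslider p e a ab) // hcompA // rbe.
by rewrite -hcompA // -htens_compl // -Harr_comp PP -rbe transposeK.
Qed.

Section Isometry.
Context (x xb : obj T) (W : arr x a) (V : arr xb ab) (Qr : arr ab ab).
Context (WW : tstar W <o> W = idm x) (WWs : W <o> tstar W = P).
Context (VV : tstar V <o> V = idm xb) (VVs : V <o> tstar V = Qr).
Context (QE : Qr <o> E = E) (EQ : E <o> Qr = Qr).

Let w := Harr W.
Let v := Harr V.

Let PW : P <o> W = W.
Proof. by rewrite -WWs compAl WW (compm1 (tcatP T)). Qed.

Let EV : E <o> V = V.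
Proof.
have QV : Qr <o> V = V by rewrite -VVs compAl VV (compm1 (tcatP T)).
by rewrite -{1}QV (Defs.compA (tcatP T)) EQ QV.
Qed.

Let pw : p @@ w = w.
Proof. by rewrite -Harr_comp PW. Qed.

(** The factor [E] is what lets [V o V^*] be absorbed: [Qr o E = E], and [E] crosses the cap [Qb^*]
    to become [P], which fixes [W]. It does no harm in the other equation, since [E o V = V]. *)
Lemma conj_subobj_equations :
  conj_equations (((tstar V <o> E) <x> tstar W) <o> Q)
                 ((tstar W <x> tstar V) <o> Qb).
Proof.
have Ps : tstar P = P by rewrite -WWs (star_comp (tcatP T)) (starK (tcatP T)).
have VEs : tstar (tstar V <o> E) = tstar E <o> V.
  by rewrite (star_comp (tcatP T)) (starK (tcatP T)).
have s1 : tstar (((tstar V <o> E) <x> tstar W) <o> Q) =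
    tstar Q <o> ((tstar E <o> V) <x> W).
  by rewrite (star_comp (tcatP T)) (tmor_star (tcatP T)) VEs (starK (tcatP T)).
have s2 : tstar ((tstar W <x> tstar V) <o> Qb) = tstar Qb <o> (W <x> V).
  by rewrite (star_comp (tcatP T)) (tmor_star (tcatP T)) !(starK (tcatP T)).
apply/conj_equationsE; rewrite /hstar /= s1 s2.
have ver : (Harr (tstar V <o> E) ** hid a) @@ r = (hstar v ** p) @@ r.
  rewrite Harr_comp htens_compl // -hcompA // er hcompA //.
  by rewrite (@hslidel (hstar v) p).
split; rewrite zigzag_sub //.
- by rewrite WW.
- rewrite -Harr_comp (Defs.compA (tcatP T)) VVs QE -/e -[Harr W]/w.
  rewrite -(@hslider w e a ab) // hcompA // rbe.
  by rewrite -hcompA // -htens_compl // pw.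
- by rewrite (Defs.compA (tcatP T)) -(star_comp (tcatP T)) EV VV.
(* The adjoint turns absorption at the cap into absorption at the cup [r], where [ver] applies. *)
- apply: (can_inj (@hstarK _ T)).
  rewrite -Harr_comp WWs !hstar_comp // !hstar_tens hstar_hid.
  rewrite -VEs /hstar /= !(starK (tcatP T)) Ps -/p -/r ver.
  rewrite -(@hslider (Harr (tstar V <o> E)) p xb a) // -hcompA // ver hcompA //.
  by rewrite -htens_comp // hcomp1m // -Harr_comp PP.
Qed.

End Isometry.

End Subobject.

Lemma zero_subobj (a x : obj T) (W : arr x a) :
  tstar W <o> W = idm x -> idm a = 0 -> idm x = 0.
Proof. by move=> <- a0; rewrite -[W](comp1m (tcatP T)) a0 comp0m compm0. Qed.

Lemma conj_subobj (T_sub : closed_sub T) (a x : obj T) (W : arr x a) :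
  tstar W <o> W = idm x ->
  (exists ab (Q : arr tunit (ab <@> a)) Qb, conj_equations Q Qb) ->
  exists xb (Q : arr tunit (xb <@> x)) Qb, conj_equations Q Qb.
Proof.
move=> WW [ab [Q [Qb QQb]]]; pose P := W <o> tstar W.
have PP : P <o> P = P.
  rewrite /P compAl [tstar W <o> (_ <o> _)](Defs.compA (tcatP T)) WW.
  by rewrite (comp1m (tcatP T)).
have [Qr [Qr_proj QE EQ]] := range_projection (transpose_idem QQb PP).
have [xb [V [VV VVs]]] := T_sub _ _ Qr_proj.
by do 3!eexists; exact: (conj_subobj_equations QQb PP WW erefl VV VVs QE EQ).
Qed.

(** The direct sum is the subobject of [a] cut out by [P], the sum of the two orthogonal range
    projections. *)
Lemma sum_subobj (T_sub : closed_sub T) (a1 a2 a x1 x2 : obj T)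
    (W1 : arr x1 a1) (W2 : arr x2 a2) (I1 : arr a1 a) (I2 : arr a2 a) :
  tstar W1 <o> W1 = idm x1 -> tstar W2 <o> W2 = idm x2 ->
  tstar I1 <o> I1 = idm a1 -> tstar I2 <o> I2 = idm a2 ->
  tstar I1 <o> I2 = 0 ->
  exists x (V1 : arr x1 x) (V2 : arr x2 x),
    [/\ tstar V1 <o> V1 = idm x1, tstar V2 <o> V2 = idm x2,
        tstar V1 <o> V2 = 0, tstar V2 <o> V1 = 0
      & V1 <o> tstar V1 + V2 <o> tstar V2 = idm x].
Proof.
move=> W11 W22 I11 I22 I12.
have [J1 J1E] : exists J1, J1 = I1 <o> W1 by eexists.
have [J2 J2E] : exists J2, J2 = I2 <o> W2 by eexists.
have cS := star_comp (tcatP T); have cA := Defs.compA (tcatP T).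
have J11 : tstar J1 <o> J1 = idm x1.
  by rewrite ?J1E ?J2E cS cA [tstar W1 <o> _ <o> _]compAl I11 (compm1 (tcatP T)).
have J22 : tstar J2 <o> J2 = idm x2.
  by rewrite ?J1E ?J2E cS cA [tstar W2 <o> _ <o> _]compAl I22 (compm1 (tcatP T)).
have J12 : tstar J1 <o> J2 = 0.
  by rewrite ?J1E ?J2E cS cA [tstar W1 <o> _ <o> _]compAl I12 compm0 comp0m.
have J21 : tstar J2 <o> J1 = 0.
  by rewrite -[tstar J2 <o> J1](starK (tcatP T)) cS (starK (tcatP T)) J12 star0.
pose P := J1 <o> tstar J1 + J2 <o> tstar J2.
have PJ1 : P <o> J1 = J1.
  by rewrite compDl !compAl J11 J21 compm0 addr0 (compm1 (tcatP T)).
have PJ2 : P <o> J2 = J2.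
  by rewrite compDl !compAl J22 J12 compm0 add0r (compm1 (tcatP T)).
have Pp : is_projection P.
  split; first by rewrite {2}/P compDr !cA PJ1 PJ2.
  by rewrite starD !cS !(starK (tcatP T)).
have [x [W [WW WWs]]] := T_sub _ _ Pp.
have H y z (A : arr y a) (B : arr z a) : P <o> B = B ->
    tstar (tstar W <o> A) <o> (tstar W <o> B) = tstar A <o> B.
  by move=> PB; rewrite cS (starK (tcatP T)) compAl [W <o> _]cA WWs PB.
exists x, (tstar W <o> J1), (tstar W <o> J2); split; rewrite ?H //.
rewrite !cS (starK (tcatP T)) !compAl ![J1 <o> _]cA ![J2 <o> _]cA -compDr -compDl.
by rewrite -/P -WWs compAl WW (compm1 (tcatP T)).
Qed.

End Conjugates.

(** * Completion under projections *)

Section ProjectionCompletion.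
Context (R : realType) (C : tensor_cstar_category R).

(** Objects of the Karoubi envelope, restricted to self-adjoint idempotents so that the splittings
    are isometries. *)
Record kobj := KObj {
  kbase : obj C;
  kproj : arr kbase kbase;
  kprojP : is_projection kproj
}.
Implicit Types x y z : kobj.

(** An object is determined by its bundled projection, so the strict laws for objects follow from
    those for arrows, applied to projections. *)
Lemma kobj_ext x y : Harr (kproj x) = Harr (kproj y) -> x = y.
Proof.
case: x => a P HP; case: y => b Q HQ /= E.
have ab : a = b by exact: (congr1 (@hdom _ _) E).
case: b / ab Q HQ E => Q HQ /Harr_inj PQ; case: Q / PQ HQ => HQ.
by rewrite (Prop_irrelevance HP HQ).
Qed.

Lemma nrm_proj a (P : arr (t := C) a a) : is_projection P -> nrm P <= 1.
Proof.
case=> PP Ps; have := nrm_sq P; rewrite Ps PP => {PP Ps} E.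
by have := nrm_ge0 P; rewrite [_ <= 1]leNgt => P0; apply/negP => P1; nra.
Qed.

Definition kcut x y (S : arr (kbase x) (kbase y)) := kproj y <o> S <o> kproj x.

Lemma kcutD x y (S U : arr (kbase x) (kbase y)) : kcut (S + U) = kcut S + kcut U.
Proof. by rewrite /kcut compDr compDl. Qed.

Lemma kcutB x y (S U : arr (kbase x) (kbase y)) : kcut (S - U) = kcut S - kcut U.
Proof. by rewrite /kcut compBr compBl. Qed.

Lemma kcutZ x y c (S : arr (kbase x) (kbase y)) : kcut (c *: S) = c *: kcut S.
Proof. by rewrite /kcut compZr compZl. Qed.

Lemma kcut_nrm x y (S : arr (kbase x) (kbase y)) : nrm (kcut S) <= nrm S.
Proof.
have Px := nrm_proj (kprojP x); have Py := nrm_proj (kprojP y).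
rewrite -[leRHS]mulr1; apply: (le_trans (nrm_comp _ _)).
rewrite ler_pM ?nrm_ge0 // -[leRHS]mul1r; apply: (le_trans (nrm_comp _ _)).
by rewrite ler_pM ?nrm_ge0.
Qed.

Lemma kcutl x y (S : arr (kbase x) (kbase y)) : kproj y <o> kcut S = kcut S.
Proof. by rewrite /kcut !(Defs.compA (tcatP C)) (kprojP y).1. Qed.

Lemma kcutr x y (S : arr (kbase x) (kbase y)) : kcut S <o> kproj x = kcut S.
Proof. by rewrite /kcut compAl (kprojP x).1. Qed.

Lemma kcutK x y (S : arr (kbase x) (kbase y)) : kcut (kcut S) = kcut S.
Proof. by rewrite {1}/kcut kcutl kcutr. Qed.

Section Hom.
Context x y.

(** The corner of arrows fixed by [kcut] is presented as a quotient by this seminorm, with [kcut S]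
    as the representative of [S]; its module structure and completeness then come from
    [quot_mod]. *)
Let p (S : arr (kbase x) (kbase y)) := nrm (kcut S).

Lemma kp_ge0 S : 0 <= p S.
Proof. exact: nrm_ge0. Qed.

Lemma kpD S U : p (S + U) <= p S + p U.
Proof. by rewrite /p kcutD nrmD. Qed.

Lemma kpZ c S : p (c *: S) = normc c * p S.
Proof. by rewrite /p kcutZ nrmZ. Qed.

Lemma kp_complete : seq_complete p.
Proof.
move=> u ub; have [j|X HX] := nrm_complete (u := fun j => kcut (u j)).
  by rewrite -kcutB; exact: ub.
exists X => e /HX [N HN]; exists N => j /HN; apply: le_lt_trans.
by rewrite /p kcutB -{1}(kcutK (u j)) -kcutB kcut_nrm.
Qed.

Lemma kp_can S : p (kcut S - S) = 0.
Proof. by rewrite /p kcutB kcutK subrr nrm0. Qed.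

Lemma kp_can_eq S U : p (S - U) = 0 -> kcut S = kcut U.
Proof. by rewrite /p kcutB => /nrm_eq0/eqP; rewrite subr_eq0 => /eqP. Qed.

Definition kseminorm : cseminorm (arr (kbase x) (kbase y)) :=
  CSeminorm kp_ge0 kpD kpZ kp_complete kp_can kp_can_eq.

Definition karr : completeNormedModType R[i] := quot_mod kseminorm.

Definition kq S : karr := qpi kseminorm S.
Definition kval (q : karr) : arr (kbase x) (kbase y) := qval q.

Lemma kval_kq S : kval (kq S) = kcut S.
Proof. by []. Qed.

Lemma kvalK q : kq (kval q) = q.
Proof. exact: qvalK. Qed.

Lemma kcut_val q : kcut (kval q) = kval q.
Proof. by case: q => S SP; exact/eqP. Qed.

Lemma kval_inj q r : kval q = kval r -> q = r.
Proof. by move=> E; rewrite -(kvalK q) E kvalK. Qed.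

Lemma kval_lin c q r : kval (c *: q + r) = c *: kval q + kval r.
Proof.
rewrite -(kcut_val q) -(kcut_val r) -kcutZ -kcutD -kval_kq.
by rewrite -{1}(kvalK q) -{1}(kvalK r) /kq -linearP.
Qed.

Lemma knrm q : nrm q = nrm (kval q).
Proof. by rewrite -nrm_qval /= /p (kcut_val q). Qed.

Lemma kvall q : kproj y <o> kval q = kval q.
Proof. by rewrite -kcut_val kcutl. Qed.

Lemma kvalr q : kval q <o> kproj x = kval q.
Proof. by rewrite -kcut_val kcutr. Qed.

Lemma kcut_fix S : kproj y <o> S = S -> S <o> kproj x = S -> kcut S = S.
Proof. by rewrite /kcut => -> ->. Qed.

End Hom.

Lemma kproj_tens x y : is_projection (kproj x <x> kproj y).
Proof.
split; first by rewrite tens_comp (kprojP x).1 (kprojP y).1.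
by rewrite (tmor_star (tcatP C)) (kprojP x).2 (kprojP y).2.
Qed.

Lemma proj_id a : is_projection (idm a : arr (t := C) a a).
Proof. by split; [rewrite (comp1m (tcatP C))|rewrite hstar_id]. Qed.

Definition kfull a := KObj (proj_id a).
Definition ktens x y := KObj (kproj_tens x y).

Definition kdata : tensor_data R := {|
  obj := kobj;
  arr := karr;
  idm := fun x => kq (x := x) (y := x) (kproj x);
  tcomp := fun x y z S U => kq (x := x) (y := z) (kval S <o> kval U);
  tstar := fun x y S => kq (x := y) (y := x) (tstar (kval S));
  tunit := kfull tunit;
  tobj := ktens;
  tmor := fun x y z t S U =>
    kq (x := ktens x z) (y := ktens y t) (kval S <x> kval U)
|}.

Lemma kval_id x : kval (idm (t := kdata) x) = kproj x.
Proof. by rewrite kval_kq kcut_fix // (kprojP x).1. Qed.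

Lemma kval_comp x y z (S : arr (t := kdata) y z) (U : arr (t := kdata) x y) :
  kval (tcomp S U) = kval S <o> kval U.
Proof.
by rewrite kval_kq kcut_fix // ?(Defs.compA (tcatP C)) ?kvall // compAl kvalr.
Qed.

Lemma kval_star x y (S : arr (t := kdata) x y) : kval (tstar S) = tstar (kval S).
Proof.
rewrite kval_kq kcut_fix //.
  by rewrite -{1}(kprojP x).2 -(star_comp (tcatP C)) kvalr.
by rewrite -{1}(kprojP y).2 -(star_comp (tcatP C)) kvall.
Qed.

Lemma kval_tens x y z t (S : arr (t := kdata) x y) (U : arr (t := kdata) z t) :
  kval (tmor S U) = kval S <x> kval U.
Proof. by rewrite kval_kq kcut_fix //= tens_comp ?kvall ?kvalr. Qed.

Lemma Harr_kval_cast (x x' y y' : obj kdata) (ex : x = x') (ey : y = y')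
    (S : arr x y) :
  Harr (kval (arr_cast ex ey S)) = Harr (kval S).
Proof. by case: x' / ex; case: y' / ey. Qed.

Lemma kobjA (x y z : obj kdata) : tobj x (tobj y z) = tobj (tobj x y) z.
Proof. by apply: kobj_ext => /=; exact: htensA (Harr _) (Harr _) (Harr _). Qed.

Lemma kobj1m (x : obj kdata) : tobj tunit x = x.
Proof. by apply: kobj_ext => /=; exact: htens1m (Harr _). Qed.

Lemma kobjm1 (x : obj kdata) : tobj x tunit = x.
Proof. by apply: kobj_ext => /=; exact: htensm1 (Harr _). Qed.

Lemma kval_sub_scale (x : obj kdata) (S : arr x x) l :
  kval (S - l *: idm x) = kval S - l *: kproj x.
Proof. by rewrite addrC -scaleNr kval_lin kval_id scaleNr addrC. Qed.

(** The spectrum in a corner is contained in the ambient one: the projection commutes with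
    [kval S - l], so cutting down an inverse gives an inverse in the corner. Positivity in the
    completion rests on this. *)
Lemma kinvertible (x : obj kdata) (S : arr x x) l :
  invertible_endo (kval S - l *: idm (kbase x)) -> invertible_endo (S - l *: idm x).
Proof.
case=> Y [ZY YZ]; set Z := _ - _ in ZY YZ; set P := kproj x.
have ZP : Z <o> P = kval S - l *: P.
  by rewrite compBl kvalr compZl (comp1m (tcatP C)).
have PZ : P <o> Z = kval S - l *: P.
  by rewrite compBr kvall compZr (compm1 (tcatP C)).
have comm : P <o> Z = Z <o> P by rewrite PZ ZP.
exists (kq (x := x) (y := x) Y); split; apply: kval_inj.
  rewrite kval_comp kval_id kval_sub_scale kval_kq -ZP /kcut.
  rewrite -!/P !(Defs.compA (tcatP C)) [Z <o> P <o> P]compAl (kprojP x).1 -comm.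
  by rewrite [P <o> Z <o> Y]compAl ZY (compm1 (tcatP C)) (kprojP x).1.
rewrite kval_comp kval_id kval_sub_scale kval_kq -PZ /kcut.
rewrite -!/P !compAl [P <o> (P <o> Z)](Defs.compA (tcatP C)) (kprojP x).1 comm.
by rewrite [Y <o> (Z <o> P)](Defs.compA (tcatP C)) YZ (comp1m (tcatP C)) (kprojP x).1.
Qed.

Lemma kdataP : is_tensor_cstar kdata.
Proof.
pose kvE := (kval_comp, kval_star, kval_tens, kval_id, kval_lin).
have H := tcatP C.
apply: (@Build_is_tensor_cstar R kdata _ _ _ _ _ _ _ _ _ _ _ _ _ _ _ _
  kobjA kobj1m kobjm1).
- by move=> *; apply: kval_inj; rewrite !kvE (Defs.compA H).
- by move=> *; apply: kval_inj; rewrite !kvE kvall.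
- by move=> *; apply: kval_inj; rewrite !kvE kvalr.
- by move=> *; apply: kval_inj; rewrite !kvE (comp_linearl H).
- by move=> *; apply: kval_inj; rewrite !kvE (comp_linearr H).
- by move=> *; apply: kval_inj; rewrite !kvE (starK H).
- by move=> *; apply: kval_inj; rewrite !kvE (star_antilinear H).
- by move=> *; apply: kval_inj; rewrite !kvE (star_comp H).
- by move=> *; rewrite !nrmE -rmorphM lecR !knrm kval_comp nrm_comp.
- by move=> *; rewrite !nrmE -rmorphXn /= !knrm !kvE nrm_sq.
- move=> x y S; split.
    by apply: kval_inj; rewrite !kvE (star_comp H) (starK H).
  move=> l nl; apply: (star_comp_positive H (kval S)).2.
  by move=> inv; apply: nl; apply: kinvertible; rewrite !kvE.
- by move=> *; apply: kval_inj; rewrite !kvE (tmor_linearl H).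
- by move=> *; apply: kval_inj; rewrite !kvE (tmor_linearr H).
- by move=> *; apply: kval_inj; rewrite !kvE.
- by move=> *; apply: kval_inj; rewrite !kvE (tmor_comp H).
- by move=> *; apply: kval_inj; rewrite !kvE (tmor_star H).
- move=> *; apply: kval_inj; apply: Harr_inj; rewrite Harr_kval_cast !kvE.
  exact: htensA (Harr _) (Harr _) (Harr _).
- move=> *; apply: kval_inj; apply: Harr_inj; rewrite Harr_kval_cast !kvE.
  exact: htens1m (Harr _).
- move=> *; apply: kval_inj; apply: Harr_inj; rewrite Harr_kval_cast !kvE.
  exact: htensm1 (Harr _).
Qed.

Definition kcat : tensor_cstar_category R := TensorCstarCategory kdataP.

Lemma kcat_comp (x y z : obj kcat) (S : arr y z) (U : arr x y) :
  kval (S <o> U) = kval S <o> kval U.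
Proof. exact: kval_comp. Qed.

Lemma kcat_star (x y : obj kcat) (S : arr x y) : kval (tstar S) = tstar (kval S).
Proof. exact: kval_star. Qed.

Lemma kcat_tens (x y z t : obj kcat) (S : arr x y) (U : arr z t) :
  kval (S <x> U) = kval S <x> kval U.
Proof. exact: kval_tens. Qed.

Lemma kcat_closed_sub : closed_sub kcat.
Proof.
move=> x P [PP Ps].
have Qp : is_projection (kval P) by rewrite /is_projection -kval_comp -kval_star PP Ps.
pose y := KObj Qp; exists y, (kq (x := y) (y := x) (kval P)).
have vW : kval (kq (x := y) (y := x) (kval P)) = kval P.
  by rewrite kval_kq kcut_fix //; [exact: (@kvall x x P)|exact: Qp.1].
split; apply: kval_inj; rewrite kval_comp kval_star vW Qp.2 Qp.1 //.
by rewrite kval_id.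
Qed.

Lemma kcat_embed (x : obj kcat) :
  exists W : arr (t := kcat) x (kfull (kbase x)), tstar W <o> W = idm x.
Proof.
exists (kq (x := x) (y := kfull (kbase x)) (kproj x)).
have vW : kval (kq (x := x) (y := kfull (kbase x)) (kproj x)) = kproj x.
  by rewrite kval_kq kcut_fix ?(kprojP x).1 //= (comp1m (tcatP C)).
apply: kval_inj; rewrite kval_comp kval_star vW (kprojP x).2 (kprojP x).1.
by rewrite kval_id.
Qed.

Lemma kfull_cut a b (S : arr a b) : kcut (x := kfull a) (y := kfull b) S = S.
Proof. by rewrite /kcut /= (comp1m (tcatP C)) (compm1 (tcatP C)). Qed.

End ProjectionCompletion.

(** * Scalars and the Gelfand transform *)

Section Scalars.
Context (R : realType) (T : tensor_cstar_category R).
Implicit Types (a b c d : obj T) (k l : arr (@tunit _ T) tunit).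

(** The right action of a scalar of [End(iota)] on [a], moved from [a <@> tunit] back to [a]. *)
Definition zact a k : arr a a :=
  arr_cast (tobjm1 (tcatP T) a) (tobjm1 (tcatP T) a) (idm a <x> k).

Lemma Harr_zact a k : Harr (zact a k) = hid a ** Harr k.
Proof. by rewrite /zact Harr_cast. Qed.

Lemma arr_cast_linear a a' b b' (ea : a = a') (eb : b = b') (t : R[i]) (S U : arr a b) :
  arr_cast ea eb (t *: S + U) = t *: arr_cast ea eb S + arr_cast ea eb U.
Proof. by case: a' / ea; case: b' / eb. Qed.

Lemma zact_linear a (t : R[i]) k l : zact a (t *: k + l) = t *: zact a k + zact a l.
Proof. by rewrite /zact (tmor_linearr (tcatP T)) arr_cast_linear. Qed.

Lemma zactB a k l : zact a (k - l) = zact a k - zact a l.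
Proof. by rewrite addrC -scaleN1r zact_linear scaleN1r addrC. Qed.

Lemma zact1 a : zact a (idm tunit) = idm a.
Proof. by apply: Harr_inj; rewrite Harr_zact htensm1. Qed.

Lemma zact_comp a k l : zact a (k <o> l) = zact a k <o> zact a l.
Proof.
by apply: Harr_inj; rewrite !(Harr_zact, Harr_comp) htens_compr.
Qed.

Lemma zact_star a k : zact a (tstar k) = tstar (zact a k).
Proof.
apply: Harr_inj; rewrite Harr_zact -[RHS]/(hstar (Harr (zact a k))) Harr_zact.
by rewrite hstar_tens hstar_hid.
Qed.

Lemma zact_unit k : zact tunit k = k.
Proof. by apply: Harr_inj; rewrite Harr_zact htens1m. Qed.

Lemma nrm_zact a k : nrm (zact a k) <= nrm k.
Proof. by rewrite nrm_cast nrm_tensr. Qed.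

Lemma zact_central a b k (S : arr a b) : S <o> zact a k = zact b k <o> S.
Proof.
apply: Harr_inj; rewrite !(Harr_zact, Harr_comp).
rewrite -[Harr S in LHS]htensm1 -[Harr S in RHS]htensm1.
by rewrite hslidel // hslider.
Qed.

Lemma zact_tensr a b k : zact (a <@> b) k = idm a <x> zact b k.
Proof.
apply: Harr_inj; rewrite -[RHS]/(hid a ** Harr (zact b k)) !Harr_zact htensA.
by rewrite htens_id.
Qed.

Context (T_linear : end_unit_linear T).

(** By [End(iota)]-linearity the left factor can carry the scalar too, so localizing either factor
    localizes a tensor product. *)
Lemma zact_tensl a b k : zact (a <@> b) k = zact a k <x> idm b.
Proof.
have zl c : Harr (zact c k) = Harr k ** hid c.
  by rewrite /zact T_linear Harr_cast.
apply: Harr_inj; rewrite -[RHS]/(Harr (zact a k) ** hid b) !zl -htensA.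
by rewrite htens_id.
Qed.

End Scalars.

Lemma normc_real (R : realType) (x : R) : normc x%:C = `|x|.
Proof. by rewrite /= expr0n /= addr0 sqrtr_sqr. Qed.

Lemma normc_dist (R : realType) (x y : R[i]) : `|normc x - normc y| <= normc (x - y).
Proof.
have H (a b : R[i]) : normc a - normc b <= normc (a - b).
  by rewrite lerBlDr -{1}(subrK b a) le_normcD.
by rewrite ler_norml H andbT lerNl opprB -[leRHS]normcN opprB H.
Qed.

Section Gelfand.
Context (R : realType) (T : tensor_cstar_category R) (Om : topologicalType).
Context (G : arr (@tunit _ T) tunit -> Om -> R[i]) (G_iso : gelfand_iso G).
Implicit Types (k l f : arr (@tunit _ T) tunit) (w : Om) (e : R).

Lemma gelfandB k l w : G (k - l) w = G k w - G l w.
Proof. by rewrite addrC -scaleN1r (gelfand_linear G_iso) mulN1r addrC. Qed.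

Lemma gelfand0 w : G 0 w = 0.
Proof. by rewrite -(subrr 0) gelfandB subrr. Qed.

Lemma gelfandZ c k w : G (c *: k) w = c * G k w.
Proof. by rewrite -[c *: k]addr0 (gelfand_linear G_iso) gelfand0 addr0. Qed.

Lemma gelfand_nrm k (M : R) : 0 <= M -> (nrm k <= M <-> forall w, normc (G k w) <= M).
Proof.
move=> M0; have := gelfand_norm G_iso k (M := M%:C); rewrite ler0c => /(_ M0).
rewrite nrmE lecR => -[H1 H2]; split=> [/H1 H w|H].
  by rewrite -lecR; exact: H.
by apply: H2 => w; rewrite -[`|_|]/((normc _)%:C) lecR.
Qed.

Lemma gelfand_le k w : normc (G k w) <= nrm k.
Proof. by have /(gelfand_nrm k (nrm_ge0 k)) := lexx (nrm k); exact. Qed.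

Lemma gelfand_continuous k w e : 0 < e ->
  nbhs w [set v | normc (G k v - G k w) < e].
Proof.
move=> e0; have : [set f | continuous (f : Om -> R[i]^o)] (G k).
  by rewrite -(gelfand_range G_iso); exists k.
move=> /(_ w) /cvgrPdist_lt /(_ e%:C); rewrite ltcR => /(_ e0).
apply: filterS => v; rewrite /= distrC.
by rewrite -[`|_|]/((normc (_ : R[i]))%:C) ltcR.
Qed.

Lemma gelfand_spectrum k w : spectrum k (G k w).
Proof.
move=> [Y [YE _]]; have := congr1 (G^~ w) YE.
rewrite /= (gelfand_mul G_iso) gelfandB gelfandZ (gelfand_one G_iso) mulr1 subrr.
by rewrite mul0r => /esym/eqP; rewrite oner_eq0.
Qed.

(** Evaluation at a point is multiplicative and unital, so it takes values in the spectrum, which is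
    nonnegative here. *)
Lemma gelfand_star_pos a (S : arr tunit a) w : 0 <= G (tstar S <o> S) w.
Proof.
have [_ pos] := star_comp_positive (tcatP T) S.
exact: pos (@gelfand_spectrum (tstar S <o> S) w).
Qed.

Definition bump w k := G k w = 1 /\ nrm k <= 1.

Lemma bump1 w : bump w (idm tunit).
Proof. by split; [exact: gelfand_one|exact: nrm_idm]. Qed.

Lemma bump_mul w k l : bump w k -> bump w l -> bump w (k <o> l).
Proof.
move=> [k1 k2] [l1 l2]; split; first by rewrite (gelfand_mul G_iso) k1 l1 mulr1.
by rewrite (le_trans (nrm_comp _ _)) // mulr_ile1 ?nrm_ge0.
Qed.

Lemma bump_star w k : bump w k -> bump w (tstar k).
Proof.
by case=> k1 k2; split; rewrite ?nrm_star // (gelfand_star G_iso) k1 rmorph1.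
Qed.

(* The function [e / (e + |f - f w|)] localizes [f] near its value at [w]. *)
Lemma bump_localize f w e : 0 < e ->
  exists k, bump w k /\ nrm (f <o> k) <= normc (G f w) + e.
Proof.
move=> e0; pose t v := normc (G f v - G f w).
have t0 v : 0 <= t v by rewrite -lecR; exact: normr_ge0 (G f v - G f w).
have et v : 0 < e + t v by rewrite ltr_wpDr.
pose h v : R[i] := (e / (e + t v))%:C.
have h_cont : continuous (h : Om -> R[i]^o).
  move=> v; apply/cvgrPdist_lt => d d0.
  have dr : d = (complex.Re d)%:C by rewrite RRe_real // gtr0_real.
  rewrite dr ltcR in d0 *.
  (* As a function of [t >= 0], [e / (e + t)] is Lipschitz with constant [e^-1], whence the
     tolerance [d * e]. *)
  have de0 : 0 < complex.Re d * e by rewrite mulr_gt0.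
  apply: filterS (gelfand_continuous f v de0) => u /= uv.
  have tuv : `|t u - t v| <= normc (G f u - G f v).
    apply: le_trans (normc_dist _ _) _.
    by rewrite opprB addrA subrK.
  rewrite /h -rmorphB /= -[`|_|]/((normc _)%:C) ltcR normc_real.
  have etu := et u; have etv := et v.
  have -> : e / (e + t v) - e / (e + t u) = e * (t u - t v) / ((e + t v) * (e + t u)).
    by field; rewrite !gt_eqF.
  rewrite !normrM normfV (gtr0_norm e0) (gtr0_norm (mulr_gt0 etv etu)).
  rewrite ltr_pdivrMr ?mulr_gt0 //.
  have H1 : e * `|t u - t v| < e * (complex.Re d * e).
    by rewrite ltr_pM2l // (le_lt_trans tuv).
  apply: (lt_le_trans H1); rewrite mulrC -mulrA ler_wpM2l ?(ltW d0) //.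
  by rewrite ler_pM ?(ltW e0) // lerDl.
have : [set f | continuous (f : Om -> R[i]^o)] h by [].
rewrite -(gelfand_range G_iso) => -[k _ kh]; exists k; split; first split.
- by rewrite kh /h /t subrr normc0 addr0 divff ?gt_eqF.
- apply/(gelfand_nrm _ ler01) => v; rewrite kh normc_real ger0_norm.
    by rewrite ler_pdivrMr // mul1r lerDl.
  by rewrite divr_ge0 ?(ltW e0) ?(ltW (et v)).
- have f0 : 0 <= normc (G f w) by rewrite -lecR; exact: normr_ge0 (G f w).
  apply/gelfand_nrm => [|v]; first by rewrite addr_ge0 ?(ltW e0).
  rewrite (gelfand_mul G_iso) kh normcM normc_real ger0_norm; last first.
    by rewrite divr_ge0 ?(ltW e0) ?(ltW (et v)).
  have fv : normc (G f v) <= normc (G f w) + t v.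
    by rewrite -{1}(subrK (G f w) (G f v)) addrC le_normcD.
  rewrite mulrA ler_pdivrMr //.
  have := ler_wpM2r (ltW e0) fv; have := mulr_ge0 f0 (t0 v).
  have := mulr_ge0 (ltW e0) (t0 v); have := sqr_ge0 e; rewrite expr2.
  by move: (normc (G f v)) (normc (G f w)) (t v) => x y z; nra.
Qed.

End Gelfand.

(** * The quotient category at a point *)

Section FibreSeminorm.
Context (R : realType) (T : tensor_cstar_category R) (T_linear : end_unit_linear T).
Context (Om : topologicalType).
Context (G : arr (@tunit _ T) tunit -> Om -> R[i]) (G_iso : gelfand_iso G) (w : Om).
Implicit Types (a b c d : obj T) (k l : arr (@tunit _ T) tunit) (e : R).

(* The norm of [S] in the fibre at [w]. *)
Definition fn a b (S : arr a b) : R :=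
  inf [set nrm (S <o> zact a k) | k in bump G w].

Let fn_has_inf a b (S : arr a b) :
  has_inf [set nrm (S <o> zact a k) | k in bump G w].
Proof.
split; last by exists 0 => _ [k _ <-]; exact: nrm_ge0.
by exists (nrm (S <o> zact a (idm tunit))), (idm tunit); first exact: bump1.
Qed.

Lemma fn_le a b (S : arr a b) k : bump G w k -> fn S <= nrm (S <o> zact a k).
Proof. by move=> kw; apply: ge_inf; [case: (fn_has_inf S)|exists k]. Qed.

Lemma fn_lt a b (S : arr a b) e : 0 < e ->
  exists k, bump G w k /\ nrm (S <o> zact a k) < fn S + e.
Proof.
move=> e0; have [_ [k kw <-] Hk] := inf_adherent e0 (fn_has_inf S).
by exists k.
Qed.

Lemma fn_ge0 a b (S : arr a b) : 0 <= fn S.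
Proof.
apply: lb_le_inf; first by case: (fn_has_inf S).
by move=> _ [k _ <-]; exact: nrm_ge0.
Qed.

Lemma nrm_zact_le a b (S : arr a b) k : nrm k <= 1 -> nrm (S <o> zact a k) <= nrm S.
Proof.
move=> k1; rewrite -[leRHS]mulr1 (le_trans (nrm_comp _ _)) // ler_pM ?nrm_ge0 //.
exact: le_trans (nrm_zact _ _) k1.
Qed.

Lemma fn_le_nrm a b (S : arr a b) : fn S <= nrm S.
Proof.
by have := fn_le S (bump1 G_iso w); rewrite zact1 (compm1 (tcatP T)).
Qed.

Lemma fn_eq0 a b (S : arr a b) : (forall e, 0 < e -> fn S <= e) -> fn S = 0.
Proof.
move=> H; apply/le_anti; rewrite fn_ge0 andbT.
by apply: ler_of_eps => e /H; rewrite add0r.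
Qed.

(** A product of two bumps is a bump that does at least as well as each factor, because scalars of
    norm at most 1 act as contractions. *)
Lemma fnD a b (S U : arr a b) : fn (S + U) <= fn S + fn U.
Proof.
apply: ler_of_eps => e e0; have e20 : 0 < e / 2 by rewrite divr_gt0.
have [k [kw kS]] := fn_lt S e20; have [l [lw lU]] := fn_lt U e20.
apply: (le_trans (fn_le _ (bump_mul G_iso kw lw))).
rewrite compDl; apply: (le_trans (nrmD _ _)).
have : nrm (S <o> zact a (k <o> l)) <= nrm (S <o> zact a k).
  by rewrite zact_comp (Defs.compA (tcatP T)) nrm_zact_le //; case: lw.
have : nrm (U <o> zact a (k <o> l)) <= nrm (U <o> zact a l).
  by rewrite zact_comp zact_central (Defs.compA (tcatP T)) nrm_zact_le //; case: kw.
lra.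
Qed.

Lemma fnZ t a b (S : arr a b) : fn (t *: S) = normc t * fn S.
Proof.
have H u (U : arr a b) : fn (u *: U) <= normc u * fn U.
  apply: ler_of_eps => e e0.
  have u1 : 0 < normc u + 1 by rewrite ltr_wpDl // -lecR; exact: normr_ge0 u.
  have [k [kw kU]] := fn_lt U (divr_gt0 e0 u1).
  apply: (le_trans (fn_le _ kw)); rewrite compZl nrmZ.
  have u0 : 0 <= normc u by rewrite -lecR; exact: normr_ge0 u.
  apply: (le_trans (ler_wpM2l u0 (ltW kU))); rewrite mulrDr lerD2l.
  by rewrite mulrA ler_pdivrMr // mulrC ler_pM2l // lerDl.
have [->|t0] := eqVneq t 0.
  rewrite scale0r normc0 mul0r; apply: fn_eq0 => e e0.
  by rewrite (le_trans (fn_le_nrm _)) // nrm0 ltW.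
apply/le_anti; rewrite H /= -{1}(scale1r S) -(mulVf t0) -scalerA.
have tr : 0 < normc t by rewrite -ltcR; have := t0; rewrite -normr_gt0.
apply: (le_trans (ler_wpM2l (ltW tr) (H _ _))).
by rewrite mulrA -normcM divff // normc1 mul1r.
Qed.

Lemma fnN a b (S : arr a b) : fn (- S) = fn S.
Proof. by rewrite -scaleN1r fnZ normcN normc1 mul1r. Qed.

Lemma fn0 a b : fn (0 : arr a b) = 0.
Proof. by rewrite -(scale0r (0 : arr a b)) fnZ normc0 mul0r. Qed.

Lemma fn_comp a b c (S : arr b c) (U : arr a b) : fn (S <o> U) <= fn S * fn U.
Proof.
apply: ler_of_eps => e e0; have S0 := fn_ge0 S; have U0 := fn_ge0 U.
have D0 : 0 < fn S + fn U + e + 1 by clear -S0 U0 e0; lra.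
(* With [x = fn S], [y = fn U] and [q <= 1], this [q] gives [(x + q) (y + q) <= x y + q (x + y + 1)
   <= x y + e]. *)
have [q [q0 q1 qD]] : exists q, [/\ 0 < q, q <= 1 & q * (fn S + fn U + e + 1) = e].
  exists (e / (fn S + fn U + e + 1)); split; first by rewrite divr_gt0.
    by rewrite ler_pdivrMr // mul1r; clear -S0 U0 e0; lra.
  by rewrite divfK // gt_eqF.
have [k [kw kS]] := fn_lt S q0; have [l [lw lU]] := fn_lt U q0.
apply: (le_trans (fn_le _ (bump_mul G_iso kw lw))).
have -> : S <o> U <o> zact a (k <o> l) = (S <o> zact b k) <o> (U <o> zact a l).
  rewrite zact_comp !compAl; congr (S <o> _).
  by rewrite (Defs.compA (tcatP T)) [U <o> zact a k]zact_central compAl.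
apply: (le_trans (nrm_comp _ _)).
apply: (le_trans (ler_pM (nrm_ge0 _) (nrm_ge0 _) (ltW kS) (ltW lU))).
have qe : 0 <= q * e by rewrite mulr_ge0 ?ltW.
have qq : q * q <= q by rewrite ger_pMl.
move: (fn S) (fn U) qD S0 U0 => x y; clear -qe qq; lra.
Qed.

Lemma fn_star a b (S : arr a b) : fn (tstar S) = fn S.
Proof.
have H c d (U : arr c d) : fn (tstar U) <= fn U.
  apply: ler_of_eps => e /(fn_lt U) [k [kw kU]].
  apply: (le_trans (fn_le _ (bump_star G_iso kw))); apply/ltW; apply: le_lt_trans kU.
  by rewrite zact_star -(star_comp (tcatP T)) nrm_star zact_central.
by apply/le_anti; rewrite H -{1}(starK (tcatP T) S) H.
Qed.

(** Localizing [S] by [k] turns [S^* o S] into [k^* S^* S k], and the extra [k^*] can only decrease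
    the norm. *)
Lemma fn_sq a b (S : arr a b) : fn (tstar S <o> S) = fn S ^+ 2.
Proof.
apply/le_anti/andP; split; first by rewrite (le_trans (fn_comp _ _)) // fn_star.
apply: ler_of_eps => e /(fn_lt (tstar S <o> S)) [k [kw kS]].
have : fn S ^+ 2 <= nrm (S <o> zact a k) ^+ 2.
  by rewrite ler_pXn2r // ?nnegrE ?fn_ge0 ?nrm_ge0 // fn_le.
move=> /le_trans; apply; apply/ltW; apply: le_lt_trans kS.
rewrite -nrm_sq (star_comp (tcatP T)) -zact_star compAl.
rewrite [tstar S <o> _](Defs.compA (tcatP T)).
by rewrite -zact_central nrm_zact_le // nrm_star; case: kw.
Qed.

Lemma fn_tens a b c d (S : arr a b) (U : arr c d) : fn (S <x> U) <= fn S * fn U.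
Proof.
have -> : S <x> U = (S <x> idm d) <o> (idm a <x> U).
  by rewrite tens_comp (comp1m (tcatP T)) (compm1 (tcatP T)).
apply: (le_trans (fn_comp _ _)); apply: ler_pM; rewrite ?fn_ge0 //.
  apply: ler_of_eps => e /(fn_lt S) [k [kw kS]].
  apply: (le_trans (fn_le _ kw)); apply/ltW; apply: le_lt_trans kS.
  rewrite (zact_tensl T_linear) tens_comp (comp1m (tcatP T)); exact: nrm_tensl.
apply: ler_of_eps => e /(fn_lt U) [k [kw kU]].
apply: (le_trans (fn_le _ kw)); apply/ltW; apply: le_lt_trans kU.
rewrite zact_tensr tens_comp (comp1m (tcatP T)); exact: nrm_tensr.
Qed.

Lemma fn_zact0 a k : G k w = 0 -> fn (zact a k) = 0.
Proof.
move=> k0; apply: fn_eq0 => e /(bump_localize G_iso k w) [l [lw kl]].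
apply: (le_trans (fn_le _ lw)); rewrite -zact_comp.
by apply: (le_trans (nrm_zact _ _)); apply: (le_trans kl); rewrite k0 normc0 add0r.
Qed.

Lemma fn_bump a b (S : arr a b) k : G k w = 1 -> fn (S <o> zact a k - S) = 0.
Proof.
move=> k1; rewrite -{2}(compm1 (tcatP T) S) -compBr -(zact1 a) -zactB.
apply/le_anti; rewrite fn_ge0 andbT (le_trans (fn_comp _ _)) // fn_zact0 ?mulr0 //.
by rewrite (gelfandB G_iso) k1 (gelfand_one G_iso) subrr.
Qed.

(* Multiplying the increments of a fast Cauchy sequence by bumps makes them small
   in [T] without changing their germs. *)
Lemma fn_complete a b : seq_complete (@fn a b).
Proof.
move=> u ub; pose q j : R := 2^-1 ^+ j.
have q0 j : 0 < q j by rewrite exprn_gt0 // invr_gt0.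
(* Starting one index later leaves room for the error: the seminorm is at most [q j.+1], and twice
   that is [q j]. *)
have ex j : exists k, bump G w k /\
    nrm ((u j.+2 - u j.+1) <o> zact a k) < q j.
  have [k [kw H]] := fn_lt (u j.+2 - u j.+1) (q0 j.+1); exists k; split=> //.
  by apply: (lt_le_trans H); have := ub j.+1; rewrite -/(q j.+1) /q exprS; lra.
have [k Hk] := choice ex.
pose d j := (u j.+2 - u j.+1) <o> zact a (k j).
pose y j := u 1%N + \sum_(i < j) d i.
have yS j : y j.+1 = y j + d j by rewrite /y big_ord_recr /= addrA.
have [j|Y HY] := nrm_complete (u := y).
  by rewrite yS [y j + _]addrC addrK; case: (Hk j) => _ /ltW.
(* [y j] is a corrected lift with the germ of [u j.+1]. *)
have yu j : fn (y j - u j.+1) = 0.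
  elim: j => [|j IH]; first by rewrite /y big_ord0 addr0 subrr fn0.
  apply/le_anti; rewrite fn_ge0 andbT.
  have -> : y j.+1 - u j.+2 = (y j - u j.+1) + (d j - (u j.+2 - u j.+1)).
    by rewrite yS opprB [RHS]addrACA addKr.
  apply: (le_trans (fnD _ _)); rewrite IH add0r fn_bump //; by case: (Hk j) => -[].
exists Y => e /HY [N HN]; exists N.+1 => -[//|j]; rewrite ltnS => /HN.
apply: le_lt_trans; rewrite -(subrK (y j) (u j.+1)) -addrA.
apply: (le_trans (fnD _ _)); rewrite -fnN opprB yu add0r; exact: fn_le_nrm.
Qed.

(** The set chosen from depends only on the class of [S], hence so does the choice; it contains [S],
    so the default [0] is never reached. *)
Definition fcan a b (S : arr a b) : arr a b := xget 0 [set U | fn (U - S) = 0].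

Lemma fcanP a b (S : arr a b) : fn (fcan S - S) = 0.
Proof.
by apply: (@xgetPex _ 0 [set U | fn (U - S) = 0]); exists S; rewrite /= subrr fn0.
Qed.

Lemma fn_tri0 a b (S U V : arr a b) : fn (S - U) = 0 -> fn (U - V) = 0 -> fn (S - V) = 0.
Proof.
move=> SU UV; apply/le_anti; rewrite fn_ge0 andbT -(subrK U S) -addrA.
by rewrite (le_trans (fnD _ _)) // SU UV addr0.
Qed.

Lemma fn_sym a b (S U : arr a b) : fn (S - U) = fn (U - S).
Proof. by rewrite -fnN opprB. Qed.

Lemma fcan_eq a b (S U : arr a b) : fn (S - U) = 0 -> fcan S = fcan U.
Proof.
move=> SU; rewrite /fcan; congr xget; apply/seteqP; split=> V /= VS.
  exact: fn_tri0 VS SU.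
by apply: fn_tri0 VS _; rewrite fn_sym.
Qed.

Definition fsem a b : cseminorm (arr a b) :=
  CSeminorm (@fn_ge0 a b) (@fnD a b) (fun t => @fnZ t a b) (@fn_complete a b)
    (@fcanP a b) (@fcan_eq a b).

Definition fq a b (S : arr a b) : quot_mod (fsem a b) := qpi (fsem a b) S.

Definition fdata : tensor_data R := {|
  obj := obj T;
  arr := fun a b => quot_mod (fsem a b);
  idm := fun a => fq (idm a);
  tcomp := fun a b c S U => fq (qval S <o> qval U);
  tstar := fun a b S => fq (tstar (qval S));
  tunit := tunit;
  tobj := @tobj _ T;
  tmor := fun a b c d S U => fq (qval S <x> qval U)
|}.

Lemma fqP a b (S U : arr a b) : fq S = fq U <-> fn (S - U) = 0.
Proof. exact: (qpiP (fsem a b) S U). Qed.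

Lemma fqK a b (S : arr a b) : fn (qval (fq S) - S) = 0.
Proof. exact: (qvalP (fsem a b) S). Qed.

Lemma fq_lin a b t (S U : arr a b) : fq (t *: S + U) = t *: fq S + fq U.
Proof. by rewrite /fq linearP. Qed.

Lemma fq_comp a b c (S : arr b c) (U : arr a b) :
  tcomp (t := fdata) (fq S) (fq U) = fq (S <o> U).
Proof.
apply/fqP; set S' := qval _; set U' := qval _.
have -> : S' <o> U' - S <o> U = (S' - S) <o> U' + S <o> (U' - U).
  by rewrite compBl compBr addrA subrK.
apply/le_anti; rewrite fn_ge0 andbT (le_trans (fnD _ _)) //.
have := fn_comp (S' - S) U'; have := fn_comp S (U' - U).
by rewrite !fqK mul0r mulr0; clear; lra.
Qed.

Lemma fq_tens a b c d (S : arr a b) (U : arr c d) :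
  tmor (t := fdata) (fq S) (fq U) = fq (S <x> U).
Proof.
apply/fqP; set S' := qval _; set U' := qval _.
have -> : S' <x> U' - S <x> U = (S' - S) <x> U' + S <x> (U' - U).
  by rewrite tensBl tensBr addrA subrK.
apply/le_anti; rewrite fn_ge0 andbT (le_trans (fnD _ _)) //.
have := fn_tens (S' - S) U'; have := fn_tens S (U' - U).
by rewrite !fqK mul0r mulr0; clear; lra.
Qed.

Lemma fq_star a b (S : arr a b) : tstar (t := fdata) (fq S) = fq (tstar S).
Proof. by apply/fqP; rewrite -starB fn_star fqK. Qed.

Lemma fq_cast (a a' b b' : obj T) (ea : a = a') (eb : b = b') (S : arr a b) :
  arr_cast (D := fdata) ea eb (fq S) = fq (arr_cast ea eb S).
Proof. by case: a' / ea; case: b' / eb. Qed.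

Lemma nrm_fq a b (S : arr a b) : nrm (fq S) = fn S.
Proof. exact: (nrm_qpi (fsem a b) S). Qed.

Lemma fqW a b (P : arr (t := fdata) a b -> Prop) :
  (forall S, P (fq S)) -> forall q, P q.
Proof. exact: quotW. Qed.

Lemma fdataP : is_tensor_cstar fdata.
Proof.
have H := tcatP T.
pose fqE := (fq_comp, fq_star, fq_tens).
apply: (@Build_is_tensor_cstar R fdata _ _ _ _ _ _ _ _ _ _ _ _ _ _ _ _
  (tobjA H) (tobj1m H) (tobjm1 H)).
- by move=> a b c d; do 3!elim/fqW=> ?; rewrite !fqE (Defs.compA H).
- by move=> a b; elim/fqW=> ?; rewrite fqE (comp1m H).
- by move=> a b; elim/fqW=> ?; rewrite fqE (compm1 H).
- move=> a b c t; do 3!elim/fqW=> ?.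
  by rewrite -fq_lin !fqE -fq_lin (comp_linearl H).
- move=> a b c t; do 3!elim/fqW=> ?.
  by rewrite -fq_lin !fqE -fq_lin (comp_linearr H).
- by move=> a b; elim/fqW=> ?; rewrite !fqE (starK H).
- move=> a b t; do 2!elim/fqW=> ?.
  by rewrite -fq_lin !fqE -fq_lin (star_antilinear H).
- by move=> a b c; do 2!elim/fqW=> ?; rewrite !fqE (star_comp H).
- move=> a b c; do 2!elim/fqW=> ?.
  by rewrite fqE !nrmE -rmorphM lecR !nrm_fq fn_comp.
- move=> a b; elim/fqW=> ?.
  by rewrite !fqE !nrmE -rmorphXn /= !nrm_fq fn_sq.
- move=> a b; elim/fqW=> S; rewrite !fqE; split.
    by rewrite fqE (star_comp H) (starK H).
  (* The spectrum can only shrink in the quotient, since an inverse in [T] maps to an inverse. *)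
  move=> l nl; apply: (star_comp_positive H S).2 => -[Y [YE EY]]; apply: nl.
  exists (fq Y); have -> : fq (tstar S <o> S) - l *: fq (idm (t := T) a) =
      fq (tstar S <o> S - l *: idm (t := T) a).
    by rewrite addrC -scaleNr -fq_lin scaleNr addrC.
  by rewrite !fqE YE EY.
- move=> a b c d t; do 3!elim/fqW=> ?.
  by rewrite -fq_lin !fqE -fq_lin (tmor_linearl H).
- move=> a b c d t; do 3!elim/fqW=> ?.
  by rewrite -fq_lin !fqE -fq_lin (tmor_linearr H).
- by move=> a b; rewrite fqE (tmor_id H).
- by move=> a b c a' b' c'; do 4!elim/fqW=> ?; rewrite !fqE (tmor_comp H).
- by move=> a b c d; do 2!elim/fqW=> ?; rewrite !fqE (tmor_star H).
- by move=> a b c a' b' c'; do 3!elim/fqW=> ?; rewrite !fqE fq_cast (tmorA H).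
- by move=> a b; elim/fqW=> ?; rewrite fqE fq_cast (tmor1m H).
- by move=> a b; elim/fqW=> ?; rewrite fqE fq_cast (tmorm1 H).
Qed.

Definition fquot : tensor_cstar_category R := TensorCstarCategory fdataP.

End FibreSeminorm.

(** * Inner products and supports *)

Section InnerProduct.
Context (R : realType) (T : tensor_cstar_category R) (T_linear : end_unit_linear T).
Context (Om : topologicalType).
Context (G : arr (@tunit _ T) tunit -> Om -> R[i]) (G_iso : gelfand_iso G).
Implicit Types (a b : obj T) (k l : arr (@tunit _ T) tunit) (w : Om).

Definition hnrm (F : harr T) := nrm (hhom F).

Lemma hnrm_ge0 F : 0 <= hnrm F.
Proof. exact: nrm_ge0. Qed.

Lemma hnrm_comp F K : hcod K = hdom F -> hnrm (F @@ K) <= hnrm F * hnrm K.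
Proof.
case: F => a b f; case: K => c d g /= E.
by case: a / E f => f; rewrite -Harr_comp; exact: nrm_comp.
Qed.

Section Solution.
Context (a : obj T) (c : conj_solution a).
Notation r := (Harr (cR c)).
Notation rb := (Harr (cRb c)).

(** [hom_ip] for an arbitrary solution [c] in place of the fixed family. *)
Definition ipc b (S S' : arr a b) : arr tunit tunit :=
  tstar (cR c) <o> (idm (cbar c) <x> (tstar S' <o> S)) <o> cR c.

(** The image of [S] under Frobenius reciprocity, from [Hom(a, b)] to [Hom(iota, cbar c <@> b)]. *)
Definition lmate b (S : arr a b) : arr tunit (cbar c <@> b) :=
  (idm (cbar c) <x> S) <o> cR c.

Lemma ipcE b (S S' : arr a b) : ipc S S' = tstar (lmate S') <o> lmate S.
Proof.
rewrite /lmate (star_comp (tcatP T)) (tmor_star (tcatP T)) hstar_id /ipc.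
rewrite !compAl; congr (_ <o> _); rewrite [RHS](Defs.compA (tcatP T)) tens_comp.
by rewrite (comp1m (tcatP T)).
Qed.

Lemma lmate_zact b (S : arr a b) k : lmate (S <o> zact a k) = lmate S <o> k.
Proof.
rewrite /lmate -{1}(comp1m (tcatP T) (idm _)) -tens_comp -zact_tensr compAl.
by rewrite -zact_central zact_unit (Defs.compA (tcatP T)).
Qed.

(* [S = (Rb^* (x) 1) o (1 (x) (1 (x) S) o R)] by the conjugation equations. *)
Lemma nrm_le_lmate b (S : arr a b) : nrm S <= nrm (cRb c) * nrm (lmate S).
Proof.
have [h1 _] := (conj_equationsE (cR c) (cRb c)).1 (conj_solutionP c).
have E : Harr S = (hstar rb ** hid b) @@ (hid a ** Harr (lmate S)).
  rewrite /lmate Harr_comp htens_compr // hcompA; [|composable|composable].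
  rewrite -[Harr (_ <x> S)]/(hid (cbar c) ** Harr S) htensA htens_id.
  rewrite (@hslidel _ _ (hstar rb) (Harr S)) //.
  rewrite -(@hslider _ _ (hstar rb) (Harr S) tunit a) // htens1m -hcompA; [|composable|composable].
  by rewrite h1 hcompm1.
rewrite -[nrm S]/(hnrm (Harr S)) E; apply: (le_trans (hnrm_comp _)); first composable.
rewrite ler_pM ?hnrm_ge0 //.
  by apply: le_trans (nrm_tensl _ _) _; rewrite /= nrm_star.
exact: nrm_tensr.
Qed.

(** For a bump [k] localizing [<S, S>], the mate of [S k] is the mate of [S] times [k], and the
    square of its norm is that of [k^* <S, S> k], at most [nrm (<S, S> k)]. *)
Lemma fn_le_ip w b (S : arr a b) :
  fn G w S ^+ 2 <= nrm (cRb c) ^+ 2 * normc (G (ipc S S) w).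
Proof.
have C0 : 0 < nrm (cRb c) ^+ 2 + 1 by rewrite ltr_wpDl // sqr_ge0.
apply: ler_of_eps => e e0.
have [k [kw kS]] := bump_localize G_iso (ipc S S) w (divr_gt0 e0 C0).
have H : fn G w S <= nrm (cRb c) * nrm (lmate S <o> k).
  rewrite -lmate_zact; exact: le_trans (fn_le G_iso S kw) (nrm_le_lmate _).
have {}H : fn G w S ^+ 2 <= nrm (cRb c) ^+ 2 * nrm (ipc S S <o> k).
  have := H; rewrite -(ler_pXn2r (n := 2)) //; last 2 first.
  - by rewrite nnegrE (fn_ge0 G_iso).
  - by rewrite nnegrE mulr_ge0 ?nrm_ge0.
  move=> /le_trans; apply; rewrite exprMn ler_wpM2l ?sqr_ge0 //.
  rewrite -nrm_sq (star_comp (tcatP T)) ipcE !compAl.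
  apply: (le_trans (nrm_comp _ _)); rewrite nrm_star.
  by rewrite -[leRHS]mul1r ler_wpM2r ?nrm_ge0 //; case: kw.
apply: (le_trans H); apply: (le_trans (ler_wpM2l (sqr_ge0 _) kS)).
rewrite mulrDr lerD2l mulrA ler_pdivrMr // mulrC ler_wpM2l ?(ltW e0) //.
by rewrite lerDl.
Qed.

Lemma ip_le_fn w b (S S' : arr a b) :
  normc (G (ipc S S') w) <= nrm (cR c) ^+ 2 * (fn G w (tstar S' <o> S)).
Proof.
have C0 : 0 < nrm (cR c) ^+ 2 + 1 by rewrite ltr_wpDl // sqr_ge0.
apply: ler_of_eps => e e0.
have [k [kw kS]] := fn_lt G_iso w (tstar S' <o> S) (divr_gt0 e0 C0).
have -> : G (ipc S S') w = G (ipc S S' <o> k) w.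
  by rewrite (gelfand_mul G_iso) kw.1 mulr1.
apply: (le_trans (gelfand_le G_iso _ _)).
have -> : ipc S S' <o> k = tstar (cR c) <o>
    ((idm (cbar c) <x> (tstar S' <o> S <o> zact a k)) <o> cR c).
  rewrite /ipc -{2}(comp1m (tcatP T) (idm (cbar c))) -tens_comp -zact_tensr.
  by rewrite !compAl -zact_central zact_unit.
apply: (le_trans (nrm_comp _ _)); rewrite nrm_star.
have H : nrm ((idm (cbar c) <x> (tstar S' <o> S <o> zact a k)) <o> cR c) <=
    nrm (cR c) * (fn G w (tstar S' <o> S) + e / (nrm (cR c) ^+ 2 + 1)).
  apply: (le_trans (nrm_comp _ _)); rewrite mulrC ler_wpM2l ?nrm_ge0 //.
  by apply: (le_trans (nrm_tensr _ _)); exact: ltW.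
apply: (le_trans (ler_wpM2l (nrm_ge0 _) H)); rewrite mulrA -expr2 mulrDr lerD2l.
by rewrite mulrA ler_pdivrMr // mulrC ler_wpM2l ?(ltW e0) // lerDl.
Qed.

Lemma ip_le_fn2 w b (S S' : arr a b) :
  normc (G (ipc S S') w) <= nrm (cR c) ^+ 2 * (fn G w S * fn G w S').
Proof.
apply: (le_trans (ip_le_fn _ _ _)); rewrite ler_wpM2l ?sqr_ge0 //.
by rewrite (le_trans (fn_comp G_iso w _ _)) // (fn_star G_iso) mulrC.
Qed.

Lemma normc_ge0 (x : R[i]) : 0 <= normc x.
Proof. by rewrite -lecR; exact: normr_ge0 x. Qed.

Lemma fn_ip0 w b (S : arr a b) : fn G w S = 0 <-> G (ipc S S) w = 0.
Proof.
split=> H.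
  have := ip_le_fn2 w S S; rewrite H !mul0r mulr0 => H0.
  by apply: eq0_normc; apply/le_anti; rewrite H0 normc_ge0.
have := fn_le_ip w S; rewrite H normc0 mulr0 => H0.
by apply/eqP; rewrite -sqrf_eq0; apply/eqP/le_anti; rewrite H0 sqr_ge0.
Qed.

Lemma ipc1 : ipc (idm a) (idm a) = tstar (cR c) <o> cR c.
Proof.
by rewrite /ipc hstar_id (comp1m (tcatP T)) (tmor_id (tcatP T)) compAl (comp1m (tcatP T)).
Qed.

End Solution.

Lemma fn_idm w a : fn G w (idm a) = 0 \/ fn G w (idm a) = 1.
Proof.
have /esym/eqP := fn_sq G_iso w (idm a).
rewrite hstar_id (comp1m (tcatP T)) expr2 -{3}[fn _ _ _]mulr1 -subr_eq0 -mulrBr.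
by rewrite mulf_eq0 subr_eq0 => /orP[] /eqP ->; [left|right].
Qed.

Lemma gelfand_le_fn k w : normc (G k w) <= fn G w k.
Proof.
apply: ler_of_eps => e /(fn_lt G_iso w k) [l [lw lk]].
have -> : G k w = G (k <o> l) w by rewrite (gelfand_mul G_iso) lw.1 mulr1.
by rewrite (le_trans (gelfand_le G_iso _ _)) // -(zact_unit l) ltW.
Qed.

Lemma fn_scalar w k : fn G w (k - G k w *: idm tunit) = 0.
Proof.
rewrite -[X in fn _ _ X]zact_unit (fn_zact0 G_iso) //.
by rewrite (gelfandB G_iso) (gelfandZ G_iso) (gelfand_one G_iso) mulr1 subrr.
Qed.

Lemma fn_idm_unit w : fn G w (idm tunit) != 0.
Proof.
apply/eqP => H; have := gelfand_le_fn (idm tunit) w.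
by rewrite H (gelfand_one G_iso) normc1 ler10.
Qed.

Lemma fn_Harr w a a' b b' (S : arr a b) (U : arr a' b') :
  Harr S = Harr U -> fn G w S = fn G w U.
Proof. exact: (congr1 (fun F : harr T => fn G w (hhom F))). Qed.

Lemma fn_comp0l w a b c (S : arr b c) (U : arr a b) :
  fn G w S = 0 -> fn G w (S <o> U) = 0.
Proof.
move=> S0; apply/le_anti; rewrite (fn_ge0 G_iso) andbT.
by rewrite (le_trans (fn_comp G_iso w _ _)) // S0 mul0r.
Qed.

Lemma fn_comp0r w a b c (S : arr b c) (U : arr a b) :
  fn G w U = 0 -> fn G w (S <o> U) = 0.
Proof.
move=> U0; apply/le_anti; rewrite (fn_ge0 G_iso) andbT.
by rewrite (le_trans (fn_comp G_iso w _ _)) // U0 mulr0.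
Qed.

Lemma fn_tens0 w a b a' b' (S : arr a b) (U : arr a' b') :
  fn G w S = 0 \/ fn G w U = 0 -> fn G w (S <x> U) = 0.
Proof.
move=> H; apply/le_anti; rewrite (fn_ge0 G_iso) andbT.
rewrite (le_trans (fn_tens T_linear G_iso w _ _)) //.
by case: H => ->; rewrite ?mul0r ?mulr0.
Qed.

(** If the germ of [idm (a <@> b)] vanished, so would that of [R^* R <x> idm b], which factors
    through it; but this germ is [idm b] times the value of [R^* R] at [w], nonzero because [idm a]
    survives. *)
Lemma fn_idm_tens w a b (c : conj_solution a) : fn G w (idm a) != 0 ->
  fn G w (idm b) != 0 -> fn G w (idm (a <@> b)) != 0.
Proof.
move=> /eqP a0 /eqP b0; apply/eqP => ab0; pose f := tstar (cR c) <o> cR c.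
have fw : G f w <> 0 by rewrite /f -ipc1 => /(fn_ip0 c).
have H1 : fn G w (idm (cbar c <@> a) <x> idm b) = 0.
  rewrite (@fn_Harr w _ _ _ _ _ (idm (cbar c) <x> idm (a <@> b))); last first.
    by rewrite -![Harr (idm _ <x> _)]/(hid _ ** hid _) !htens_id (tobjA (tcatP T)).
  by apply: fn_tens0; right.
have H2 : fn G w (f <x> idm b) = 0.
  have -> : f <x> idm b = (tstar (cR c) <x> idm b) <o>
      ((idm (cbar c <@> a) <x> idm b) <o> (cR c <x> idm b)).
    by rewrite !tens_comp !(comp1m (tcatP T)).
  by apply: fn_comp0r; exact: fn_comp0l.
have H3 : fn G w (zact b f) = 0.
  rewrite -H2; apply: fn_Harr; rewrite /zact T_linear Harr_cast.
  by [].
have H4 : fn G w (zact b (f - G f w *: idm tunit)) = 0.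
  apply: (fn_zact0 G_iso).
  by rewrite (gelfandB G_iso) (gelfandZ G_iso) (gelfand_one G_iso) mulr1 subrr.
have H5 : fn G w (G f w *: idm b) = 0.
  have -> : G f w *: idm b = zact b f - zact b (f - G f w *: idm tunit).
    rewrite zactB opprB addrCA subrr addr0 -[X in zact b X]addr0 zact_linear.
    by rewrite zact1 -(subrr (idm tunit)) zactB subrr addr0.
  apply/le_anti; rewrite (fn_ge0 G_iso) andbT (le_trans (fnD G_iso w _ _)) //.
  by rewrite (fnN G_iso) H3 H4 addr0.
move: H5; rewrite (fnZ G_iso) => /eqP; rewrite mulf_eq0 => /orP[] /eqP // H.
by apply: fw; exact: eq0_normc.
Qed.

(** [R] factors through the identity of [cbar c <@> a], so if the conjugate died at [w], [R^* R]
    would vanish there. *)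
Lemma fn_idm_conj w a (c : conj_solution a) :
  fn G w (idm a) != 0 -> fn G w (idm (cbar c)) != 0.
Proof.
move=> /eqP a0; apply/eqP => b0; apply: a0; apply/(fn_ip0 c); rewrite ipc1.
apply: eq0_normc; apply/le_anti; rewrite normc_ge0 andbT.
apply: (le_trans (gelfand_le_fn _ _)); rewrite -[cR c](comp1m (tcatP T)).
by rewrite -(tmor_id (tcatP T)) fn_comp0r // fn_comp0l // fn_tens0 //; left.
Qed.

Context (sol : forall rho : obj T, conj_solution rho).

(* On the fibres where [idm a] survives it has norm 1, so [R^* o R] is bounded
   below there: its support is the clopen set where it does not vanish. *)
Lemma obj_supportP w a : obj_support G sol a w <-> fn G w (idm a) != 0.
Proof.
pose c := sol a; pose f := tstar (cR c) <o> cR c.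
have fE v : fn G v (idm a) = 0 <-> G f v = 0 by rewrite /f -ipc1; exact: fn_ip0.
split; last first.
  move=> /eqP w0; apply: subset_closure => /=; apply/eqP => H; apply: w0.
  exact/fE.
move=> cl; apply/eqP => /fE w0.
(* Where [idm a] survives, [1 <= C * |f v|]; near [w], if [f] vanishes at [w], [|f v| < C^-1]. *)
pose C := nrm (cRb c) ^+ 2 + 1.
have C0 : 0 < C by rewrite /C ltr_wpDl // sqr_ge0.
have Ci : 0 < C^-1 by rewrite invr_gt0.
have [v [/= fv vw]] := cl _ (gelfand_continuous G_iso f w Ci).
have := fn_le_ip c v (idm a); rewrite ipc1 -/f.
have [v0|->] := fn_idm v a; first by move: fv; rewrite (fE v).1 ?eqxx.
move: vw; rewrite w0 subr0 expr1n => vw H.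
suff : (1 : R) < 1 by rewrite ltxx.
apply: (le_lt_trans H); rewrite -(mulfV (lt0r_neq0 C0)).
apply: (@le_lt_trans _ _ (C * normc (G f v))); last by rewrite ltr_pM2l.
by rewrite ler_wpM2r ?normc_ge0 // /C lerDl.
Qed.

End InnerProduct.

(** * GNS completions recognized by norm equivalence *)

Section GnsCriterion.
Context (R : realType) (V : lmodType R[i]) (H : completeNormedModType R[i]).
Context (f : V -> V -> R[i]) (q : {linear V -> H}).
Context (q_surj : forall x, exists v, q v = x).
Context (f_lin : forall t u v x, f (t *: u + v) x = t * f u x + f v x).
Context (f_herm : forall u v, f u v = Num.conj (f v u)).
Context (f_pos : forall u, 0 <= f u u).
Context (C1 C2 : R) (C1_ge0 : 0 <= C1) (C2_ge0 : 0 <= C2).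
Context (f_lower : forall u, nrm (q u) ^+ 2 <= C1 * normc (f u u)).
Context (f_upper : forall u v, normc (f u v) <= C2 * (nrm (q u) * nrm (q v))).

Let g x : V := xget 0 [set v | q v = x].
Let gK x : q (g x) = x.
Proof. by apply: (@xgetPex _ 0 [set v | q v = x]); exact: q_surj. Qed.

Definition gns_dot (x y : H) : R[i] := f (g x) (g y).

Let fB u v x : f (u - v) x = f u x - f v x.
Proof. by rewrite addrC -scaleN1r f_lin mulN1r addrC. Qed.

(** The upper bound forces [f] to vanish against the kernel of [q], so the form descends to [H]
    whatever preimages [g] picks. *)
Let f_q u u' x : q u = q u' -> f u x = f u' x.
Proof.
move=> E; apply/eqP; rewrite -subr_eq0 -fB; apply/eqP/eq0_normc/le_anti.
have := f_upper (u - u') x; rewrite linearB E subrr nrm0 mul0r mulr0 => ->.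
by rewrite normc_ge0.
Qed.

Lemma gns_dotE u v : gns_dot (q u) (q v) = f u v.
Proof.
by rewrite /gns_dot (@f_q _ u) ?gK // f_herm (@f_q _ v) ?gK // -f_herm.
Qed.

Lemma gns_dot_linl y : GRing.linear_for *%R (gns_dot^~ y).
Proof.
move=> t x x'; rewrite -(gK x) -(gK x') -(gK y) -linearP !gns_dotE f_lin.
by [].
Qed.

Lemma gns_dot_herm x y : gns_dot x y = (-1) ^+ false * Num.conj (gns_dot y x).
Proof. by rewrite expr0 mul1r; exact: f_herm. Qed.

Lemma gns_dot_linr x : GRing.linear_for (Num.conj \; *%R) (gns_dot x).
Proof.
move=> t y y' /=; rewrite gns_dot_herm (gns_dot_herm x y) (gns_dot_herm x y').
by rewrite !expr0 !mul1r gns_dot_linl rmorphD rmorphM.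
Qed.

Lemma gns_dot_pos x : x != 0 -> 0 < gns_dot x x.
Proof.
move=> x0; rewrite lt_neqAle f_pos andbT eq_sym; apply: contra x0 => /eqP H0.
have := f_lower (g x); rewrite -/(gns_dot x x) H0 normc0 mulr0 gK => H1.
apply/eqP/nrm_eq0/eqP; rewrite -sqrf_eq0; apply/eqP/le_anti.
by rewrite H1 sqr_ge0.
Qed.

HB.instance Definition _ := @bilinear_isBilinear.Build R[i] H H R[i] _ _ gns_dot
  (pair gns_dot_linl gns_dot_linr).
HB.instance Definition _ :=
  @isHermitianSesquilinear.Build R[i] H false Num.conj gns_dot gns_dot_herm.
HB.instance Definition _ := @isDotProduct.Build R[i] H gns_dot gns_dot_pos.

Let dotE x : gns_dot x x = (normc (gns_dot x x))%:C.
Proof. by rewrite -[LHS]ger0_norm //; exact: f_pos. Qed.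

Let dot_lower x : nrm x ^+ 2 <= C1 * normc (gns_dot x x).
Proof. by have := f_lower (g x); rewrite gK. Qed.

Let dot_upper x : normc (gns_dot x x) <= C2 * nrm x ^+ 2.
Proof. by have := f_upper (g x) (g x); rewrite gK -expr2. Qed.

(** Surjectivity makes density immediate, and the two bounds make the inner product norm equivalent
    to the complete norm of [H]. *)
Lemma gns_criterion : gns_completion f q.
Proof.
have [D1 D2] : 0 < C1 + 1 /\ 0 < C2 + 1 by split; rewrite ltr_wpDl.
exists (gns_dot : {dot H for @Num.conj R[i]}); split=> [||u uC].
- exact: gns_dotE.
- move=> x e e0; exists (g x); rewrite gK subrr /= dotE.
  suff -> : normc (gns_dot 0 0) = 0 by [].
  by apply/le_anti; rewrite normc_ge0 (le_trans (dot_upper _)) // nrm0 expr0n mulr0.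
have [e e0|x Hx] := nrm_cauchy_cvg (u := u).
  have d0 : 0 < e ^+ 2 / (C1 + 1) by rewrite divr_gt0 // exprn_gt0.
  have [N HN] := uC (e ^+ 2 / (C1 + 1))%:C (ltac:(by rewrite ltcR)).
  exists N => m n Nm Nn; have := HN m n Nm Nn; rewrite /= dotE ltcR => H1.
  rewrite -(ltr_pXn2r (n := 2)) ?nnegrE ?nrm_ge0 ?(ltW e0) //.
  apply: (le_lt_trans (dot_lower _)).
  apply: (@le_lt_trans _ _ ((C1 + 1) * normc (gns_dot (u m - u n) (u m - u n)))).
    by rewrite ler_wpM2r ?normc_ge0 // lerDl.
  by rewrite mulrC -ltr_pdivlMr.
exists x => e e0; have er : e = (complex.Re e)%:C by rewrite RRe_real // gtr0_real.
rewrite er ltcR in e0 *; move: (complex.Re e) e0 => {er}e0' e0.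
pose d := Num.sqrt (e0' / (C2 + 1)).
have q0 : 0 < e0' / (C2 + 1) by rewrite divr_gt0.
have d0 : 0 < d by rewrite sqrtr_gt0.
have [N HN] := Hx _ d0; exists N => n /HN Nn; rewrite /= dotE ltcR.
apply: (le_lt_trans (dot_upper _)).
have H1 : nrm (u n - x) ^+ 2 < e0' / (C2 + 1).
  rewrite -[ltRHS](sqr_sqrtr (ltW q0)) -/d.
  by rewrite ltr_pXn2r ?nnegrE ?nrm_ge0 ?(ltW d0).
apply: (@le_lt_trans _ _ ((C2 + 1) * nrm (u n - x) ^+ 2)).
  by rewrite ler_wpM2r ?sqr_ge0 // lerDl.
by rewrite mulrC -ltr_pdivlMr.
Qed.

End GnsCriterion.

(** * The fibre category *)

Section Fibre.
Context (R : realType) (T : tensor_cstar_category R) (T_linear : end_unit_linear T).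
Context (Om : topologicalType).
Context (G : arr (@tunit _ T) tunit -> Om -> R[i]) (G_iso : gelfand_iso G).
Context (sol : forall rho : obj T, conj_solution rho) (w : Om).
Implicit Types (a b c d : obj T).

Notation Tw := (fquot T_linear G_iso w).
Notation K := (kcat Tw).
Notation full a := (kfull (C := Tw) a : obj K).

Definition germ a b (S : arr a b) : arr (t := K) (full a) (full b) :=
  kq (x := full a) (y := full b) (fq G_iso w S).

Lemma kval_germ a b (S : arr a b) : kval (germ S) = fq G_iso w S.
Proof. by rewrite /germ kval_kq (kfull_cut (C := Tw)). Qed.

Lemma germ_linear a b : linear (@germ a b).
Proof.
move=> t S U; apply: kval_inj.
rewrite [RHS]kval_lin !kval_germ; exact: fq_lin.
Qed.

HB.instance Definition _ a b :=
  GRing.isLinear.Build R[i] (arr a b) (arr (t := K) (full a) (full b)) _ (@germ a b)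
    (@germ_linear a b).

Lemma germB a b (S U : arr a b) : germ (S - U) = germ S - germ U.
Proof. exact: linearB. Qed.

Lemma germZ a b t (S : arr a b) : germ (t *: S) = t *: germ S.
Proof. exact: linearZ. Qed.

Lemma germ0 a b : germ (0 : arr a b) = 0.
Proof. exact: linear0. Qed.

Lemma nrm_germ a b (S : arr a b) : nrm (germ S) = fn G w S.
Proof. by rewrite knrm kval_germ nrm_fq. Qed.

Lemma germ_surj a b (X : arr (t := K) (full a) (full b)) : exists S, germ S = X.
Proof.
exists (qval (kval X)); apply: kval_inj; rewrite kval_germ.
exact: qvalK.
Qed.

Lemma germ_id a : germ (idm a) = idm (full a).
Proof. by []. Qed.

Lemma germ_comp a b c (S : arr b c) (U : arr a b) :
  germ (S <o> U) = germ S <o> germ U.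
Proof. by apply: kval_inj; rewrite kcat_comp !kval_germ -fq_comp. Qed.

Lemma germ_star a b (S : arr a b) : germ (tstar S) = tstar (germ S).
Proof. by apply: kval_inj; rewrite kcat_star !kval_germ -fq_star. Qed.

(** Not a conversion: the projection of the right-hand side is [idm a <x> idm b], an identity only
    through [tmor_id]. *)
Lemma kfull_tens a b : full (a <@> b) = full a <@> full b.
Proof.
apply: kobj_ext; exact: (congr1 Harr (esym (tmor_id (tcatP Tw) a b))).
Qed.

Lemma kcat_Harr (x x' y y' : obj K) (S : arr x y) (U : arr x' y') :
  x = x' -> y = y' -> Harr (kval S) = Harr (kval U) -> Harr S = Harr U.
Proof.
move=> ex ey; case: x' / ex U => U; case: y' / ey U => U.
by move=> /Harr_inj /kval_inj ->.
Qed.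

Lemma germ_tens a b c d (S : arr a b) (U : arr c d) :
  Harr (germ (S <x> U)) = Harr (germ S <x> germ U).
Proof.
apply: kcat_Harr; rewrite ?kfull_tens //.
by rewrite kcat_tens !kval_germ -(fq_tens T_linear).
Qed.

Definition hgerm (F : harr T) : harr K := Harr (germ (hhom F)).

Lemma hgerm_comp F L : hcod L = hdom F -> hgerm (F @@ L) = hgerm F @@ hgerm L.
Proof.
case: F => a b f; case: L => c d g /= E; case: a / E f => f.
rewrite -(Harr_comp f g).
have -> : hgerm (Harr (f <o> g)) = Harr (germ f <o> germ g) by rewrite -germ_comp.
exact: (@Harr_comp _ K _ _ _ (germ f) (germ g)).
Qed.

Lemma hgerm_tens F L : hgerm (F ** L) = hgerm F ** hgerm L.
Proof. exact: germ_tens. Qed.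

Lemma hgerm_id a : hgerm (hid a) = hid (full a).
Proof. by []. Qed.

Lemma hgerm_star F : hgerm (hstar F) = hstar (hgerm F).
Proof. exact: (congr1 Harr (germ_star (hhom F))). Qed.

Lemma germ_conj_equations a ab (Q : arr tunit (ab <@> a)) (Qb : arr tunit (a <@> ab))
    (Q' : arr (t := K) tunit (full ab <@> full a))
    (Qb' : arr (t := K) tunit (full a <@> full ab)) :
  conj_equations Q Qb -> Harr Q' = hgerm (Harr Q) -> Harr Qb' = hgerm (Harr Qb) ->
  conj_equations Q' Qb'.
Proof.
move=> /conj_equationsE[E1 E2] EQ EQb; apply/conj_equationsE.
rewrite EQ EQb -!hgerm_id -!hgerm_star -!hgerm_tens -!hgerm_comp; [|composable|composable].
by rewrite E1 E2.
Qed.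

Lemma fibre_closed_conj : closed_conj K.
Proof.
move=> x; have [W WW] := kcat_embed x.
apply: (conj_subobj (@kcat_closed_sub _ Tw) WW).
pose c := sol (kbase x : obj T); exists (full (cbar c)).
exists (arr_cast (D := K) erefl (kfull_tens _ _) (germ (cR c))).
exists (arr_cast (D := K) erefl (kfull_tens _ _) (germ (cRb c))).
by apply: (germ_conj_equations (conj_solutionP c)); rewrite Harr_cast.
Qed.

Lemma fibre_closed_sum : closed_sum T -> closed_sum K.
Proof.
move=> T_sum x1 x2; have [W1 WW1] := kcat_embed x1; have [W2 WW2] := kcat_embed x2.
have [a [I1 [I2 [I11 I22 I12 _ _]]]] := T_sum (kbase x1 : obj T) (kbase x2).
apply: (sum_subobj (@kcat_closed_sub _ Tw) (a := full a)
  (I1 := germ I1) (I2 := germ I2) WW1 WW2).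
- by rewrite -germ_star -germ_comp I11 germ_id.
- by rewrite -germ_star -germ_comp I22 germ_id.
- by rewrite -germ_star -germ_comp I12 germ0.
Qed.

(** The germ of a scalar and its value at [w] determine each other: evaluation is bounded by [fn],
    and a scalar differs from its value times the identity by a null arrow. So [ev], the value of
    any lift, is inverse to [t |-> t 1]. *)
Lemma fibre_simple_unit : simple_unit K.
Proof.
have cE (t : R[i]) : germ (t *: idm tunit) = t *: idm (tunit : obj K).
  by rewrite germZ germ_id.
pose ev (X : arr (t := K) tunit tunit) := G (xget 0 [set k | germ k = X]) w.
have evE k : ev (germ k) = G k w.
  rewrite /ev; set l := xget _ _.
  have /= lk : [set l | germ l = germ k] l by apply: xgetPex; exists k.
  apply/eqP; rewrite -subr_eq0 -(gelfandB G_iso); apply/eqP/eq0_normc/le_anti.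
  rewrite normc_ge0 andbT.
  apply: (le_trans (gelfand_le_fn G_iso (l - k) w)).
  by rewrite -nrm_germ germB lk subrr nrm0.
exists ev => [t|X].
  by rewrite -cE evE (gelfandZ G_iso) (gelfand_one G_iso) mulr1.
have [k <-] := germ_surj X; rewrite evE -cE; apply/eqP.
rewrite eq_sym -subr_eq0 -germB; apply/eqP/nrm_eq0.
by rewrite nrm_germ (fn_scalar G_iso).
Qed.

Let supp a := obj_support G sol a w.

Lemma supp_unit : supp tunit.
Proof. by apply/(obj_supportP G_iso); exact: fn_idm_unit. Qed.

Lemma supp_tens a b : supp a -> supp b -> supp (a <@> b).
Proof.
move=> /(obj_supportP G_iso) ha /(obj_supportP G_iso) hb.
by apply/(obj_supportP G_iso); exact: (fn_idm_tens T_linear G_iso (sol a)).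
Qed.

Lemma supp_conj a (c : conj_solution a) : supp a -> supp (cbar c).
Proof.
move=> /(obj_supportP G_iso) ha.
by apply/(obj_supportP G_iso); exact: (fn_idm_conj T_linear G_iso c).
Qed.

(* The objects of [T] not supported at [w] are kept, as zero objects. *)
Definition fibre : fibre_data G sol w := {|
  fcat := K;
  fobj := fun a _ => full a : obj K;
  fgerm := fun a b _ _ => @germ a b : {linear arr a b -> arr (full a) (full b)};
  support_unit := supp_unit;
  support_tobj := supp_tens;
  fobj_unit := erefl;
  fobj_tobj := fun a b _ _ => kfull_tens a b
|}.

Lemma fibre_gnsP : fibre_gns fibre.
Proof.
move=> a b ha hb; pose c := sol a.
have ipE (S S' : arr a b) : hom_ip sol S S' = ipc c S S' by [].
have ip_lin t (u v x : arr a b) :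
    hom_ip sol (t *: u + v) x = t *: hom_ip sol u x + hom_ip sol v x.
  by rewrite /hom_ip compDr compZr tensDr tensZr compDr compZr compDl compZl.
apply: (@gns_criterion _ _ _ _ _ _ _ _ _ (nrm (cRb c) ^+ 2) (nrm (cR c) ^+ 2)).
- exact: germ_surj.
- by move=> t u v x; rewrite ip_lin (gelfand_linear G_iso).
- move=> u v; rewrite -(gelfand_star G_iso) !ipE !ipcE.
  by rewrite (star_comp (tcatP T)) (starK (tcatP T)).
- by move=> u; rewrite ipE ipcE; exact: (gelfand_star_pos G_iso).
- exact: sqr_ge0.
- exact: sqr_ge0.
- by move=> S; rewrite /= nrm_germ; exact: (fn_le_ip G_iso).
- by move=> S S'; rewrite /= !nrm_germ; exact: (ip_le_fn2 G_iso).
Qed.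

Lemma fibre_categoryP : is_fibre_category fibre.
Proof.
split; first exact: fibre_gnsP.
- move=> a ha X; rewrite /= !nrmE nrm_germ; split=> [N N0|e e0].
    rewrite nrmE lecR; have {}N0 : fn G w N = 0 by apply/(fn_ip0 G_iso (sol a)).
    rewrite -{1}(addrK N X) (le_trans (fnD G_iso w _ _)) // (fnN G_iso) N0 addr0.
    exact: (fn_le_nrm G_iso).
  have er : e = (complex.Re e)%:C by rewrite RRe_real // gtr0_real.
  rewrite er ltcR in e0 *; have [k [kw kX]] := fn_lt G_iso w X e0.
  (* Adding this to [X] gives [X k], whose norm nearly attains the infimum; it is null because [k]
     takes the value 1 at [w]. *)
  exists (X <o> zact a k - X).
    apply/(fn_ip0 G_iso (sol a)); by apply: (fn_bump G_iso); case: kw.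
  by rewrite addrC subrK nrmE -rmorphD /= ltcR.
- move=> a b ha hb S; rewrite /= !nrmE !nrm_germ (fn_sq G_iso) rmorphXn /= sqrCK //.
  by rewrite ler0c (fn_ge0 G_iso).
split; first exact: kcat_closed_sub.
move=> x; have [xw|xw] := pselect (supp (kbase x)).
  by exists (kbase x), xw; exact: kcat_embed.
(* Over an unsupported base the object is zero, so the zero arrow into the unit is an isometry. *)
exists tunit, supp_unit, 0; rewrite compm0; apply/esym/nrm_eq0.
have [W WW] := kcat_embed x.
have : fn G w (idm (kbase x : obj T)) = 0.
  by apply: contrapT => /eqP x0; apply: xw; apply/(obj_supportP G_iso).
rewrite -nrm_germ => /nrm_eq0; rewrite germ_id => E.
by rewrite (zero_subobj WW E) nrm0.
Qed.

(** Sections record germs only where both objects are supported; this shows that nothing is lost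
    elsewhere, as injectivity of [arrow_section] requires. *)
Lemma germ_eq_unsupported a b (S : arr a b) : ~ (supp a /\ supp b) -> fn G w S = 0.
Proof.
move=> nab; have [a0|/eqP a0] := eqVneq (fn G w (idm a)) 0.
  by rewrite -[S](compm1 (tcatP T)); exact: fn_comp0r.
rewrite -[S](comp1m (tcatP T)); apply: fn_comp0l => //; apply: contrapT => b0.
by apply: nab; split; apply/(obj_supportP G_iso); apply/eqP.
Qed.

Lemma Harr_germ_unit_tobj a b (ha : supp a) (hb : supp b) (Q : arr tunit (a <@> b)) :
  Harr (@germ_unit_tobj _ _ _ _ _ _ fibre _ _ ha hb Q) = hgerm (Harr Q).
Proof. by rewrite /germ_unit_tobj Harr_cast. Qed.

Lemma fibre_conj_solutions : preserves_conj_solutions fibre.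
Proof.
move=> a ha c; exists (supp_conj c ha).
by apply: (germ_conj_equations (conj_solutionP c)); exact: Harr_germ_unit_tobj.
Qed.

Lemma fibre_conj_arrows : preserves_conj_arrows fibre.
Proof.
move=> a b c d ha hb hab hbb S; apply: Harr_inj.
apply: etrans _ (esym (conj_arrowE _ _ _)); rewrite !Harr_germ_unit_tobj.
rewrite -[LHS]/(hgerm (Harr (conj_arrow (cRb c) (cR d) S))) conj_arrowE.
rewrite !hgerm_comp; [|composable..]; rewrite !hgerm_tens !hgerm_star !hgerm_id.
by [].
Qed.

End Fibre.

Theorem proposition2p32 (R : realType) (T : tensor_cstar_category R)
    (T_linear : end_unit_linear T) (T_conj : closed_conj T)
    (T_sub : closed_sub T) (T_sum : closed_sum T)
    (Om : topologicalType) (Om_compact : compact [set: Om])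
    (Om_hausdorff : hausdorff_space Om)
    (G : arr (@tunit R T) (@tunit R T) -> Om -> R[i]) (G_iso : gelfand_iso G)
    (sol : forall rho : obj T, conj_solution rho) :
  exists F : forall w : Om, fibre_data G sol w,
    [/\ forall w : Om,
          [/\ is_fibre_category (F w), simple_unit (F w), closed_conj (F w)
            & closed_sum (F w)],
        forall rho sigma : obj T,
          set_bij [set: arr rho sigma] (continuous_sections F rho sigma)
            (arrow_section F)
      & forall w : Om,
          [/\ preserves_comp (F w), preserves_tensor (F w),
              preserves_star (F w), preserves_conj_solutions (F w)
            & preserves_conj_arrows (F w)]].
Proof.
exists (fibre T_linear G_iso sol); split=> [w|rho sigma|w].
- split; [exact: fibre_categoryP|exact: fibre_simple_unit|exact: fibre_closed_conj|].
  exact: fibre_closed_sum.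
- split=> [S _|S S' _ _ E|s [S _ <-]]; [by exists S| |by exists S].
  apply/eqP; rewrite -subr_eq0; apply/eqP/nrm_eq0/le_anti.
  rewrite nrm_ge0 andbT; set D := S - S'.
  have D0 w : fn G w D = 0.
    have [[hr hs]|] := pselect (obj_support G sol rho w /\ obj_support G sol sigma w).
      rewrite -(nrm_germ T_linear G_iso) linearB /=.
      have := congr1 (fun s => s w hr hs) E; rewrite /arrow_section /= => ->.
      by rewrite subrr nrm0.
    exact: germ_eq_unsupported.
  (* The function [<D, D>] vanishes at every point, hence is zero; then the mate of [D] is zero, and
     it controls the norm of [D]. *)
  have ip0 : ipc (sol rho) D D = 0.
    apply/nrm_eq0/le_anti; rewrite nrm_ge0 andbT.
    apply/(gelfand_nrm G_iso _ (lexx 0)) => w.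
    by rewrite ((fn_ip0 G_iso (sol rho) w D).1 (D0 w)) normc0.
  apply: (le_trans (nrm_le_lmate (sol rho) D)).
  suff -> : lmate (sol rho) D = 0 by rewrite nrm0 mulr0.
  by apply/nrm_eq0/eqP; rewrite -sqrf_eq0 -nrm_sq -ipcE ip0 nrm0.
- split.
  + by split=> *; [exact: germ_id|exact: germ_comp].
  + by move=> *; apply: arr_castP; exact: germ_tens.
  + by move=> *; exact: germ_star.
  + exact: fibre_conj_solutions.
  + exact: fibre_conj_arrows.
Qed.
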